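(* Let $S\subset\mathbb{R}^3$ be a homothetical surface in Euclidean space, i.e. the graph of a function $z=f(x)g(y)$ where $f:I\subset\mathbb{R}\to\mathbb{R}$ and $g:J\subset\mathbb{R}\to\mathbb{R}$ are smooth functions, and suppose $S$ has constant Gauss curvature $K$. Then $K=0$. Furthermore, $S$ is either a cylindrical surface over a plane curve, or $S$ is the graph of one of the following functions: (1) $z(x,y)=a e^{bx+cy}$, with $a,b,c>0$; or (2) $z(x,y)=\left(\frac{bx}{m}+d\right)^{m}\left(\frac{cy}{m-1}+e\right)^{1-m}$, with $b,c,d,e,m\in\mathbb{R}$, $b,c\neq 0$, $m\neq 0,1$.
   Context: Euclidean space $\mathbb{R}^3$ with its standard metric. A cylindrical surface is a ruled surface whose rulings are all parallel to a fixed direction.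
   Formalization: Form (2) is allowed an overall sign ±1, since as stated the claim fails: z = -√x·√y on x,y>0 is homothetical and flat, but neither cylindrical nor of form (1) or (2). *)

(* Defs.v *)
From Stdlib Require Import Reals.
From Coquelicot Require Import Coquelicot.
Open Scope R_scope.

Definition open_itv (a b : Rbar) (x : R) : Prop :=
  Rbar_lt a x /\ Rbar_lt x b.

Definition smooth_on (D : R -> Prop) (f : R -> R) : Prop :=
  forall (n : nat) (x : R), D x -> ex_derive (Derive_n f n) x.

Definition gauss_curvature_graph (z : R -> R -> R) (x y : R) : R :=
  let zx  := Derive (fun s => z s y) x in
  let zy  := Derive (fun t => z x t) y in
  let zxx := Derive (fun s => Derive (fun s' => z s' y) s) x in
  let zyy := Derive (fun t => Derive (fun t' => z x t') t) y in
  let zxy := Derive (fun t => Derive (fun s => z s t) x) y in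
  (zxx * zyy - zxy ^ 2) / (1 + zx ^ 2 + zy ^ 2) ^ 2.

(* The graph of z over D1 x D2 (a convex domain) is a cylindrical surface:
   there is a fixed non-vertical direction (w1, w2, w3) such that the line
   through every point of the graph in that direction stays on the graph
   (as long as its projection stays in the domain). *)
Definition cylindrical_graph (D1 D2 : R -> Prop) (z : R -> R -> R) : Prop :=
  exists w1 w2 w3 : R, (w1 <> 0 \/ w2 <> 0) /\
    forall x y t : R, D1 x -> D2 y -> D1 (x + t * w1) -> D2 (y + t * w2) ->
      z (x + t * w1) (y + t * w2) = z x y + t * w3.

(* Real power u^m: exp(m ln u) for u > 0; for an integer exponent m = k
   and u <= 0 the usual integer power u^k; otherwise (undefined) 0. *)
Definition gpow (u m : R) : R :=
  if Rlt_dec 0 u then Rpower u m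
  else if Req_EM_T (IZR (up m)) (m + 1) then powerRZ u (up m - 1)%Z
  else 0.

(* Main.v *)
Require Import Defs.
From Stdlib Require Import Reals Lra Lia Psatz Classical.
From Coquelicot Require Import Coquelicot.
Open Scope R_scope.

(** With [U = f^2], [p = f'^2], [a = f f''] and [w = g^2], [q = g'^2], [b = g g''], the
    curvature equation reads [a b - p q = K (1 + p w + U q)^2]. If [K <> 0], comparing
    three values of [y] gives two independent conics containing the curve [(U, p)], which
    is therefore a line [p = al U + be]; then [a = al U], and the equation becomes
    polynomial in [U] and [w], which forces [K = 0].

    If [K = 0] and neither factor is constant, the variables separate into
    [f f'' = k f'^2] and [g g'' = g'^2 / k]. For [k = 1] both factors are exponential and
    the graph is a cylinder. Otherwise, with [m = 1 / (1 - k)], [f^(1/m)] is affine as long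
    as [f] does not vanish. If [m] is not a natural number, [f] cannot reach [0], because
    some derivative of [t^m] blows up at [0]. If it is, [f^(m+1)] vanishes wherever
    [f' <> 0], hence everywhere, and [f] is a polynomial. *)

(** * Conics through a plane curve *)

Lemma affine_two_roots (c0 c1 u v : R) :
  u <> v -> c0 + c1 * u = 0 -> c0 + c1 * v = 0 -> c0 = 0 /\ c1 = 0.
Proof.
  intros Huv Hu Hv.
  assert (Hc : c1 * (u - v) = 0) by lra.
  apply Rmult_integral in Hc; destruct Hc as [Hc|Hc]; [|lra].
  subst c1; split; lra.
Qed.

(** The divided difference with respect to [u] has one degree less and still vanishes at the other
    roots. The same descent gives the cubic and quartic cases. *)
Lemma quadratic_three_roots (c0 c1 c2 u v w : R) :
  u <> v -> u <> w -> v <> w ->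
  c0 + c1 * u + c2 * u^2 = 0 -> c0 + c1 * v + c2 * v^2 = 0 ->
  c0 + c1 * w + c2 * w^2 = 0 -> c0 = 0 /\ c1 = 0 /\ c2 = 0.
Proof.
  intros Huv Huw Hvw Hu Hv Hw.
  destruct (affine_two_roots (c1 + c2 * u) c2 v w Hvw) as [H1 H2].
  - apply (Rmult_eq_reg_l (v - u)); [|lra].
    transitivity ((c0 + c1 * v + c2 * v^2) - (c0 + c1 * u + c2 * u^2)); [ring|lra].
  - apply (Rmult_eq_reg_l (w - u)); [|lra].
    transitivity ((c0 + c1 * w + c2 * w^2) - (c0 + c1 * u + c2 * u^2)); [ring|lra].
  - subst c2; assert (c1 = 0) by lra; subst c1; repeat split; lra.
Qed.

Lemma cubic_four_roots (c0 c1 c2 c3 u v w s : R) :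
  u <> v -> u <> w -> u <> s -> v <> w -> v <> s -> w <> s ->
  c0 + c1 * u + c2 * u^2 + c3 * u^3 = 0 -> c0 + c1 * v + c2 * v^2 + c3 * v^3 = 0 ->
  c0 + c1 * w + c2 * w^2 + c3 * w^3 = 0 -> c0 + c1 * s + c2 * s^2 + c3 * s^3 = 0 ->
  c0 = 0 /\ c1 = 0 /\ c2 = 0 /\ c3 = 0.
Proof.
  intros Huv Huw Hus Hvw Hvs Hws Hu Hv Hw Hs.
  assert (Hdiv : forall t, u <> t -> c0 + c1 * t + c2 * t^2 + c3 * t^3 = 0 ->
    (c1 + c2 * u + c3 * u^2) + (c2 + c3 * u) * t + c3 * t^2 = 0).
  { intros t Ht H. apply (Rmult_eq_reg_l (t - u)); [|lra].
    transitivity ((c0 + c1 * t + c2 * t^2 + c3 * t^3)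
      - (c0 + c1 * u + c2 * u^2 + c3 * u^3)); [ring|lra]. }
  destruct (quadratic_three_roots _ _ _ v w s Hvw Hvs Hws
    (Hdiv v Huv Hv) (Hdiv w Huw Hw) (Hdiv s Hus Hs)) as [H1 [H2 H3]].
  subst c3; assert (c2 = 0) by lra; subst c2; assert (c1 = 0) by lra; subst c1; repeat split; lra.
Qed.

Lemma quartic_five_roots (c0 c1 c2 c3 c4 u v w s r : R) :
  u <> v -> u <> w -> u <> s -> u <> r -> v <> w -> v <> s -> v <> r ->
  w <> s -> w <> r -> s <> r ->
  (forall t, t = u \/ t = v \/ t = w \/ t = s \/ t = r ->
    c0 + c1 * t + c2 * t^2 + c3 * t^3 + c4 * t^4 = 0) ->
  c0 = 0 /\ c1 = 0 /\ c2 = 0 /\ c3 = 0 /\ c4 = 0.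
Proof.
  intros Huv Huw Hus Hur Hvw Hvs Hvr Hws Hwr Hsr H.
  assert (Hu := H u ltac:(auto)).
  assert (Hdiv : forall t, u <> t -> t = v \/ t = w \/ t = s \/ t = r ->
    (c1 + c2 * u + c3 * u^2 + c4 * u^3) + (c2 + c3 * u + c4 * u^2) * t
      + (c3 + c4 * u) * t^2 + c4 * t^3 = 0).
  { intros t Ht Hin. assert (Ht' := H t ltac:(tauto)).
    apply (Rmult_eq_reg_l (t - u)); [|lra].
    transitivity ((c0 + c1 * t + c2 * t^2 + c3 * t^3 + c4 * t^4)
      - (c0 + c1 * u + c2 * u^2 + c3 * u^3 + c4 * u^4)); [ring|].
    rewrite Ht', Hu; ring. }
  destruct (cubic_four_roots _ _ _ _ v w s r Hvw Hvs Hvr Hws Hwr Hsr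
    (Hdiv v Huv ltac:(tauto)) (Hdiv w Huw ltac:(tauto))
    (Hdiv s Hus ltac:(tauto)) (Hdiv r Hur ltac:(tauto))) as [H1 [H2 [H3 H4]]].
  subst c4; assert (c3 = 0) by lra; subst c3; assert (c2 = 0) by lra; subst c2;
  assert (c1 = 0) by lra; subst c1; repeat split; lra.
Qed.

(** The cross product works unless it is zero. In that case the two vectors are parallel, and a
    vector orthogonal to a nonzero one of them is enough. *)
Lemma exists_orthogonal (u1 u2 u3 v1 v2 v3 : R) :
  exists l1 l2 l3 : R, (l1 <> 0 \/ l2 <> 0 \/ l3 <> 0) /\
    l1 * u1 + l2 * u2 + l3 * u3 = 0 /\ l1 * v1 + l2 * v2 + l3 * v3 = 0.
Proof.
  destruct (Req_dec (u2 * v3 - u3 * v2) 0) as [H1|H1];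
  [ destruct (Req_dec (u3 * v1 - u1 * v3) 0) as [H2|H2];
    [ destruct (Req_dec (u1 * v2 - u2 * v1) 0) as [H3|H3] |] |];
  try (exists (u2 * v3 - u3 * v2), (u3 * v1 - u1 * v3), (u1 * v2 - u2 * v1);
       split; [tauto | split; ring]).
  destruct (Req_dec u1 0) as [E1|E1]; destruct (Req_dec u2 0) as [E2|E2];
  try (exists u2, (- u1), 0; split; [|split; lra];
       first [left; assumption | right; left; lra]).
  destruct (Req_dec u3 0) as [E3|E3].
  2: exists 0, u3, 0; subst; split; [tauto | split; lra].
  subst u1 u2 u3.
  destruct (Req_dec v1 0) as [F1|F1]; destruct (Req_dec v2 0) as [F2|F2];
  try (exists v2, (- v1), 0; split; [|split; lra];
       first [left; assumption | right; left; lra]).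
  exists 1, 0, 0; subst; split; [left; lra | split; lra].
Qed.

(** Eliminating [p] between two conics leaves a quartic in [U]; five distinct values of [U] force
    all its coefficients to vanish. *)
Definition five_values (X : R -> Prop) (U : R -> R) : Prop :=
  exists x1 x2 x3 x4 x5 : R, (X x1 /\ X x2 /\ X x3 /\ X x4 /\ X x5) /\
    (U x1 <> U x2 /\ U x1 <> U x3 /\ U x1 <> U x4 /\ U x1 <> U x5) /\
    (U x2 <> U x3 /\ U x2 <> U x4 /\ U x2 <> U x5) /\
    (U x3 <> U x4 /\ U x3 <> U x5) /\ U x4 <> U x5.

Lemma quartic_zero (X : R -> Prop) (U : R -> R) (c0 c1 c2 c3 c4 : R) :
  five_values X U ->
  (forall x, X x -> c0 + c1 * U x + c2 * (U x)^2 + c3 * (U x)^3 + c4 * (U x)^4 = 0) ->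
  c0 = 0 /\ c1 = 0 /\ c2 = 0 /\ c3 = 0 /\ c4 = 0.
Proof.
  intros (x1 & x2 & x3 & x4 & x5 & HX & H1 & H2 & H3 & H4) H.
  apply (quartic_five_roots c0 c1 c2 c3 c4 (U x1) (U x2) (U x3) (U x4) (U x5));
    try tauto.
  intros t [->|[->|[->|[->| ->]]]]; apply H; tauto.
Qed.

(* Two independent conics meet in a finite set unless they share a line; the first
   conic has no [p^2] term, so it presents [p] as a quotient of polynomials in [U]. *)
Lemma affine_of_two_conics (X : R -> Prop) (U p : R -> R)
    (B1 C1 D1 E1 F1 A B2 C2 D2 E2 F2 : R) :
  five_values X U ->
  (forall x, X x -> p x * (B1 + C1 * U x) + (D1 + E1 * U x + F1 * (U x)^2) = 0) ->
  (forall x, X x -> A * (p x)^2 + p x * (B2 + C2 * U x)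
                      + (D2 + E2 * U x + F2 * (U x)^2) = 0) ->
  ~ (B1 = 0 /\ C1 = 0 /\ D1 = 0 /\ E1 = 0 /\ F1 = 0) ->
  (forall mu, ~ (A = 0 /\ B2 = mu * B1 /\ C2 = mu * C1 /\ D2 = mu * D1
                 /\ E2 = mu * E1 /\ F2 = mu * F1)) ->
  exists al be r : R, forall x, X x -> U x <> r -> p x = al * U x + be.
Proof.
  intros HU R1 R2 Hn1 Hind.
  destruct (Req_dec C1 0) as [HC|HC].
  - subst C1. destruct (Req_dec B1 0) as [HB|HB].
    + exfalso. subst B1. apply Hn1.
      destruct (quartic_zero X U D1 E1 F1 0 0 HU) as (?&?&?&_).
      * intros x Hx. generalize (R1 x Hx). lra.
      * tauto.
    + set (n0 := - D1 / B1). set (n1 := - E1 / B1). set (n2 := - F1 / B1).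
      assert (Hp : forall x, X x -> p x = n0 + n1 * U x + n2 * (U x)^2).
      { intros x Hx. apply (Rmult_eq_reg_r B1); [|assumption].
        transitivity (- (D1 + E1 * U x + F1 * (U x)^2)).
        - generalize (R1 x Hx); lra.
        - unfold n0, n1, n2; field; assumption. }
      destruct (Req_dec n2 0) as [Hn2|Hn2].
      * exists n1, n0, 0. intros x Hx _. rewrite (Hp x Hx), Hn2; ring.
      (* Substituting this parabola into the second conic gives a quartic in [U] with leading
         coefficient [A * n2^2]. Hence [A = 0], then [C2 = 0], and the second conic is [B2 / B1]
         times the first. *)
      * exfalso.
        destruct (quartic_zero X U
          (A * n0^2 + n0 * B2 + D2)
          (A * 2 * n0 * n1 + n0 * C2 + n1 * B2 + E2)
          (A * (n1^2 + 2 * n0 * n2) + n1 * C2 + n2 * B2 + F2)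
          (A * 2 * n1 * n2 + n2 * C2) (A * n2^2) HU) as (e0&e1&e2&e3&e4).
        { intros x Hx. rewrite <- (R2 x Hx), (Hp x Hx). ring. }
        assert (HA : A = 0).
        { apply Rmult_integral in e4; destruct e4 as [e4|e4]; [assumption|].
          exfalso; apply (pow_nonzero n2 2 Hn2 e4). }
        subst A.
        assert (HC2 : C2 = 0).
        { assert (e : n2 * C2 = 0) by lra.
          apply Rmult_integral in e; tauto. }
        subst C2. apply (Hind (B2 / B1)).
        assert (D2 = - (n0 * B2)) by lra. assert (E2 = - (n1 * B2)) by lra.
        assert (F2 = - (n2 * B2)) by lra. subst D2 E2 F2.
        unfold n0, n1, n2. repeat split; field; assumption.
  - set (r := - B1 / C1).
    assert (HB : B1 = - r * C1) by (unfold r; field; assumption).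
    (* With [L_i = B_i + C_i U] and [N_i = D_i + E_i U + F_i U^2], the first conic reads
       [p L1 = - N1]. Multiplying the second by [L1^2] eliminates [p] and gives
       [A N1^2 - N1 L1 L2 + N2 L1^2 = 0]. *)
    destruct (quartic_zero X U
      (A * D1^2 - D1 * B1 * B2 + D2 * B1^2)
      (A * 2 * D1 * E1 - (E1 * B1 * B2 + D1 * (C1 * B2 + B1 * C2))
        + (E2 * B1^2 + D2 * 2 * B1 * C1))
      (A * (E1^2 + 2 * D1 * F1)
        - (F1 * B1 * B2 + E1 * (C1 * B2 + B1 * C2) + D1 * C1 * C2)
        + (F2 * B1^2 + E2 * 2 * B1 * C1 + D2 * C1^2))
      (A * 2 * E1 * F1 - (F1 * (C1 * B2 + B1 * C2) + E1 * C1 * C2)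
        + (F2 * 2 * B1 * C1 + E2 * C1^2))
      (A * F1^2 - F1 * C1 * C2 + F2 * C1^2) HU) as (e0&e1&e2&e3&e4).
    { intros x Hx.
      assert (HN : D1 + E1 * U x + F1 * (U x)^2 = - (p x * (B1 + C1 * U x)))
        by (generalize (R1 x Hx); lra).
      transitivity (A * (D1 + E1 * U x + F1 * (U x)^2)^2
        - (D1 + E1 * U x + F1 * (U x)^2) * (B1 + C1 * U x) * (B2 + C2 * U x)
        + (D2 + E2 * U x + F2 * (U x)^2) * (B1 + C1 * U x)^2); [ring|].
      rewrite HN.
      transitivity ((B1 + C1 * U x)^2 * (A * (p x)^2 + p x * (B2 + C2 * U x)
                      + (D2 + E2 * U x + F2 * (U x)^2))); [ring|].
      rewrite (R2 x Hx); ring. }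
    (* If the numerator vanishes at the root [r] of the denominator, [U - r] cancels and the
       quotient is affine. Nothing is learnt about [p] where [U = r], whence the exception in the
       conclusion. *)
    destruct (Req_dec (D1 + E1 * r + F1 * r^2) 0) as [HN|HN].
    + exists (- F1 / C1), (- (E1 + F1 * r) / C1), r. intros x Hx Hr.
      apply (Rmult_eq_reg_r (C1 * (U x - r))).
      2: apply Rmult_integral_contrapositive; split; lra.
      transitivity (- (D1 + E1 * U x + F1 * (U x)^2)).
      { rewrite <- (Rplus_0_l (- _)), <- (R1 x Hx), HB; ring. }
      transitivity (- (F1 * U x + (E1 + F1 * r)) * (U x - r)).
      { replace D1 with (- (E1 * r + F1 * r^2)) by lra. ring. }
      field; assumption.
    + exfalso.
      assert (HA : A = 0).
      (* At [U = r] only the term [A N1^2] of the quartic survives. *)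
      { assert (e : A * (D1 + E1 * r + F1 * r^2)^2 = 0).
        { transitivity ((A * D1^2 - D1 * B1 * B2 + D2 * B1^2) +
      (A * 2 * D1 * E1 - (E1 * B1 * B2 + D1 * (C1 * B2 + B1 * C2))
        + (E2 * B1^2 + D2 * 2 * B1 * C1)) * r +
      (A * (E1^2 + 2 * D1 * F1)
        - (F1 * B1 * B2 + E1 * (C1 * B2 + B1 * C2) + D1 * C1 * C2)
        + (F2 * B1^2 + E2 * 2 * B1 * C1 + D2 * C1^2)) * r^2 +
      (A * 2 * E1 * F1 - (F1 * (C1 * B2 + B1 * C2) + E1 * C1 * C2)
        + (F2 * 2 * B1 * C1 + E2 * C1^2)) * r^3 +
      (A * F1^2 - F1 * C1 * C2 + F2 * C1^2) * r^4).
          - rewrite HB; ring.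
          - rewrite e0, e1, e2, e3, e4; ring. }
        apply Rmult_integral in e; destruct e as [e|e]; [assumption|].
        exfalso; apply (pow_nonzero _ 2 HN e). }
      subst A.
      (* Coefficients of N2 L1 - N1 L2, with L_i = B_i + C_i U and N_i = D_i + E_i U + F_i U^2;
         with A = 0, the quartic above is its product by L1. *)
      set (z0 := D2 * B1 - D1 * B2).
      set (z1 := E2 * B1 + D2 * C1 - E1 * B2 - D1 * C2).
      set (z2 := F2 * B1 + E2 * C1 - F1 * B2 - E1 * C2).
      set (z3 := F2 * C1 - F1 * C2).
      assert (h3 : z3 = 0).
      { apply (Rmult_eq_reg_r C1); [|assumption]. unfold z3; lra. }
      assert (h2 : z2 = 0).
      { apply (Rmult_eq_reg_r C1); [|assumption].
        transitivity (z2 * C1 + z3 * B1); [rewrite h3; ring|]. unfold z2, z3; lra. }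
      assert (h1 : z1 = 0).
      { apply (Rmult_eq_reg_r C1); [|assumption].
        transitivity (z1 * C1 + z2 * B1); [rewrite h2; ring|]. unfold z1, z2; lra. }
      assert (h0 : z0 = 0).
      { apply (Rmult_eq_reg_r C1); [|assumption].
        transitivity (z0 * C1 + z1 * B1); [rewrite h1; ring|]. unfold z0, z1; lra. }
      (* At [U = r] the identity [N2 L1 = N1 L2] leaves [N1 L2 = 0] with [N1] nonzero. So [L2] is
         [C2 / C1] times [L1], and [N2] is the same multiple of [N1]. *)
      assert (HL : B2 + C2 * r = 0).
      { apply (Rmult_eq_reg_r (D1 + E1 * r + F1 * r^2)); [|assumption].
        transitivity (- (z0 + z1 * r + z2 * r^2 + z3 * r^3)).
        - unfold z0, z1, z2, z3. rewrite HB. ring.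
        - rewrite h0, h1, h2, h3; ring. }
      assert (HB2 : B2 = - r * C2) by lra.
      apply (Hind (C2 / C1)).
      assert (hF : F2 = C2 / C1 * F1).
      { apply (Rmult_eq_reg_r C1); [|assumption].
        transitivity (F1 * C2); [unfold z3 in h3; lra | field; assumption]. }
      assert (hE : E2 = C2 / C1 * E1).
      { apply (Rmult_eq_reg_r C1); [|assumption].
        transitivity (E1 * C2 + (z2 - B1 * F2 + F1 * B2)); [unfold z2; ring|].
        rewrite h2, hF, HB, HB2. field; assumption. }
      assert (hD : D2 = C2 / C1 * D1).
      { apply (Rmult_eq_reg_r C1); [|assumption].
        transitivity (D1 * C2 + (z1 - B1 * E2 + E1 * B2)); [unfold z1; ring|].
        rewrite h1, hE, HB, HB2. field; assumption. }
      repeat split; try assumption.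
      * rewrite HB2, HB; field; assumption.
      * field; assumption.
Qed.

(* [a b - p q = K (1 + p w + U q)^2] says that the quadratic polynomials in [(U, p)]
   indexed by [y] are all proportional along the curve; three values of [y] therefore
   give two conics through it, independent because [1, w, w^2] are. *)
Lemma affine_of_separated (X : R -> Prop) (U p a : R -> R) (K : R)
    (b1 q1 w1 b2 q2 w2 b3 q3 w3 : R) :
  K <> 0 -> five_values X U -> w1 <> w2 -> w1 <> w3 -> w2 <> w3 ->
  (forall x, X x -> a x * b1 - p x * q1 = K * (1 + p x * w1 + U x * q1)^2) ->
  (forall x, X x -> a x * b2 - p x * q2 = K * (1 + p x * w2 + U x * q2)^2) ->
  (forall x, X x -> a x * b3 - p x * q3 = K * (1 + p x * w3 + U x * q3)^2) ->
  exists al be r : R, forall x, X x -> U x <> r -> p x = al * U x + be.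
Proof.
  intros HK HU W12 W13 W23 H1 H2 H3.
  (* A combination whose coefficients of [1], [p], [U] and [p^2] all vanish is orthogonal to
     [(1, 1, 1)], [(w1, w2, w3)] and the vector of the squares of the [w]. These form a Vandermonde
     system, so the weights are zero. *)
  assert (Hvdm : forall l1 l2 l3, K * (l1 + l2 + l3) = 0 ->
    2 * K * (l1 * w1 + l2 * w2 + l3 * w3) + (l1 * q1 + l2 * q2 + l3 * q3) = 0 ->
    2 * K * (l1 * q1 + l2 * q2 + l3 * q3) = 0 ->
    K * (l1 * w1^2 + l2 * w2^2 + l3 * w3^2) = 0 -> l1 = 0 /\ l2 = 0 /\ l3 = 0).
  { intros l1 l2 l3 h0 hp hU hpp.
    assert (s0 : l1 + l2 + l3 = 0) by (apply (Rmult_eq_reg_l K); lra).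
    assert (s2 : l1 * w1^2 + l2 * w2^2 + l3 * w3^2 = 0)
      by (apply (Rmult_eq_reg_l K); lra).
    assert (sq : l1 * q1 + l2 * q2 + l3 * q3 = 0)
      by (apply (Rmult_eq_reg_l (2 * K)); lra).
    assert (s1 : l1 * w1 + l2 * w2 + l3 * w3 = 0)
      by (apply (Rmult_eq_reg_l (2 * K)); lra).
    assert (v1 : l1 * ((w1 - w2) * (w1 - w3)) = 0).
    { transitivity ((l1 * w1^2 + l2 * w2^2 + l3 * w3^2)
        - (w2 + w3) * (l1 * w1 + l2 * w2 + l3 * w3) + w2 * w3 * (l1 + l2 + l3));
        [ring | rewrite s0, s1, s2; ring]. }
    assert (v2 : l2 * ((w2 - w1) * (w2 - w3)) = 0).
    { transitivity ((l1 * w1^2 + l2 * w2^2 + l3 * w3^2)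
        - (w1 + w3) * (l1 * w1 + l2 * w2 + l3 * w3) + w1 * w3 * (l1 + l2 + l3));
        [ring | rewrite s0, s1, s2; ring]. }
    assert (l1 = 0).
    { apply Rmult_integral in v1; destruct v1 as [v1|v1]; [assumption|].
      apply Rmult_integral in v1; lra. }
    assert (l2 = 0).
    { apply Rmult_integral in v2; destruct v2 as [v2|v2]; [assumption|].
      apply Rmult_integral in v2; lra. }
    lra. }
  (* Orthogonality to the [b] eliminates [a]. The weights [l] also cancel the [p^2] term, and the
     weights [k] are taken orthogonal to [l] so that they cannot be proportional to it. *)
  destruct (exists_orthogonal b1 b2 b3 (w1^2) (w2^2) (w3^2))
    as (l1 & l2 & l3 & Hl & Hlb & Hlw).
  destruct (exists_orthogonal b1 b2 b3 l1 l2 l3)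
    as (k1 & k2 & k3 & Hk & Hkb & Hkl).
  assert (Hrel : forall s1 s2 s3, s1 * b1 + s2 * b2 + s3 * b3 = 0 ->
    forall x, X x -> K * (s1 * w1^2 + s2 * w2^2 + s3 * w3^2) * (p x)^2
      + p x * ((2 * K * (s1 * w1 + s2 * w2 + s3 * w3) + (s1 * q1 + s2 * q2 + s3 * q3))
               + 2 * K * (s1 * w1 * q1 + s2 * w2 * q2 + s3 * w3 * q3) * U x)
      + (K * (s1 + s2 + s3) + 2 * K * (s1 * q1 + s2 * q2 + s3 * q3) * U x
         + K * (s1 * q1^2 + s2 * q2^2 + s3 * q3^2) * (U x)^2) = 0).
  { intros s1 s2 s3 Hs x Hx.
    transitivity (s1 * (p x * q1 + K * (1 + p x * w1 + U x * q1)^2)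
      + s2 * (p x * q2 + K * (1 + p x * w2 + U x * q2)^2)
      + s3 * (p x * q3 + K * (1 + p x * w3 + U x * q3)^2)); [ring|].
    rewrite <- (H1 x Hx), <- (H2 x Hx), <- (H3 x Hx).
    transitivity (a x * (s1 * b1 + s2 * b2 + s3 * b3)); [ring | rewrite Hs; ring]. }
  assert (Hrel1 : forall x, X x ->
    p x * ((2 * K * (l1 * w1 + l2 * w2 + l3 * w3) + (l1 * q1 + l2 * q2 + l3 * q3))
           + 2 * K * (l1 * w1 * q1 + l2 * w2 * q2 + l3 * w3 * q3) * U x)
    + (K * (l1 + l2 + l3) + 2 * K * (l1 * q1 + l2 * q2 + l3 * q3) * U x
       + K * (l1 * q1^2 + l2 * q2^2 + l3 * q3^2) * (U x)^2) = 0).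
  { intros x Hx. rewrite <- (Hrel l1 l2 l3 Hlb x Hx), Hlw. ring. }
  eapply (affine_of_two_conics X U p _ _ _ _ _ _ _ _ _ _ _ HU Hrel1).
  - exact (Hrel k1 k2 k3 Hkb).
  - intros (n1 & _ & n3 & n4 & _).
    destruct (Hvdm l1 l2 l3 n3 n1 n4) as (?&?&?); [rewrite Hlw; ring | lra].
  (* Proportional conics would give [k = mu * l] by [Hvdm]; since [k] is orthogonal to [l], its
     squared length would be zero. *)
  - intros mu (nA & nB & _ & nD & nE & _).
    destruct (Hvdm (k1 - mu * l1) (k2 - mu * l2) (k3 - mu * l3)) as (e1&e2&e3).
    + lra.
    + lra.
    + lra.
    + transitivity (K * (k1 * w1^2 + k2 * w2^2 + k3 * w3^2)
        - mu * K * (l1 * w1^2 + l2 * w2^2 + l3 * w3^2)); [ring|].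
      rewrite nA, Hlw; ring.
    + assert (m1 : k1 = mu * l1) by lra. assert (m2 : k2 = mu * l2) by lra.
      assert (m3 : k3 = mu * l3) by lra.
      assert (Hsq : k1^2 + k2^2 + k3^2 = 0).
      { transitivity (mu * (k1 * l1 + k2 * l2 + k3 * l3)).
        - replace (k1^2) with (mu * l1 * k1) by (rewrite <- m1; ring).
          replace (k2^2) with (mu * l2 * k2) by (rewrite <- m2; ring).
          replace (k3^2) with (mu * l3 * k3) by (rewrite <- m3; ring).
          ring.
        - rewrite Hkl; ring. }
      assert (Hz : forall k, k^2 <= 0 -> k = 0).
      { intros k h. destruct (Req_dec k 0) as [->|hk]; [reflexivity|].
        generalize (pow2_gt_0 k hk); lra. }
      generalize (pow2_ge_0 k1) (pow2_ge_0 k2) (pow2_ge_0 k3); intros g1 g2 g3.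
      destruct Hk as [Hk|[Hk|Hk]]; apply Hk; apply Hz; lra.
Qed.

(** * Vanishing of the curvature *)

Definition convex (D : R -> Prop) : Prop :=
  forall x y z : R, D x -> D y -> x <= z <= y -> D z.

Lemma open_itv_open (a b : Rbar) : open (open_itv a b).
Proof. apply open_and; [apply open_Rbar_gt | apply open_Rbar_lt]. Qed.

Lemma open_itv_convex (a b : Rbar) : convex (open_itv a b).
Proof.
  intros x y z [Hx _] [_ Hy] [Hxz Hzy]; split.
  - apply Rbar_lt_le_trans with (1 := Hx); exact Hxz.
  - apply Rbar_le_lt_trans with (2 := Hy); exact Hzy.
Qed.

Lemma open_itv_inhabited (a b : Rbar) : Rbar_lt a b -> exists x, open_itv a b x.
Proof.
  intros H. unfold open_itv. destruct a as [a| |], b as [b| |]; simpl in *; try tauto.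
  - exists ((a + b) / 2); lra.
  - exists (a + 1); lra.
  - exists (b - 1); lra.
  - exists 0; tauto.
Qed.

Lemma derive_zero_const (D : R -> Prop) (h : R -> R) :
  convex D -> (forall x, D x -> is_derive h x 0) ->
  forall x y, D x -> D y -> h x = h y.
Proof.
  intros HD Hh.
  assert (Hlt : forall x y, D x -> D y -> x < y -> h x = h y).
  { intros x y Hx Hy Hxy. apply (eq_is_derive h x y); [|assumption].
    intros t Ht. apply Hh, (HD x y); assumption. }
  intros x y Hx Hy. destruct (Rtotal_order x y) as [H|[->|H]].
  - now apply Hlt.
  - reflexivity.
  - symmetry; now apply Hlt.
Qed.

(** The denominator of the curvature is positive and can be cleared. The partial derivatives factor
    because the total operator [Derive] commutes with scalars. *)
Lemma curvature_homothetical (f g : R -> R) (K x y : R) :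
  gauss_curvature_graph (fun u v => f u * g v) x y = K ->
  f x * Derive_n f 2 x * (g y * Derive_n g 2 y) - (Derive f x)^2 * (Derive g y)^2
    = K * (1 + (Derive f x)^2 * (g y)^2 + (f x)^2 * (Derive g y)^2)^2.
Proof.
  unfold gauss_curvature_graph.
  rewrite (Derive_ext (fun t => Derive (fun s => f s * g t) x)
             (fun t => Derive f x * g t)) by (intros; apply Derive_scal_l).
  rewrite (Derive_ext (fun s => Derive (fun s' => f s' * g y) s)
             (fun s => Derive f s * g y)) by (intros; apply Derive_scal_l).
  rewrite (Derive_ext (fun t => Derive (fun t' => f x * g t') t)
             (fun t => f x * Derive g t)) by (intros; apply Derive_scal).
  rewrite !Derive_scal_l, !Derive_scal.
  change (Derive_n f 2 x) with (Derive (Derive f) x).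
  change (Derive_n g 2 y) with (Derive (Derive g) y).
  intros <-.
  generalize (pow2_ge_0 (Derive f x * g y)) (pow2_ge_0 (f x * Derive g y)); intros h1 h2.
  field; lra.
Qed.

(** The derivative [2 f f'] of [f^2] has no zero near [x0], so the mean value theorem makes [f^2]
    injective there, and any five points will do. *)
Lemma square_injective_near (f : R -> R) (x0 d : R) :
  (forall x, Rabs (x - x0) < d -> ex_derive f x /\ f x * Derive f x <> 0) ->
  0 < d -> five_values (fun x => Rabs (x - x0) < d) (fun x => (f x)^2).
Proof.
  intros Hf Hd.
  assert (Hinj : forall x y, Rabs (x - x0) < d -> Rabs (y - x0) < d -> x < y ->
                   (f x)^2 <> (f y)^2).
  { intros x y Hx Hy Hxy Heq.
    apply Rabs_def2 in Hx; apply Rabs_def2 in Hy.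
    destruct (MVT_gen (fun t => (f t)^2) x y (fun t => 2 * (f t * Derive f t)))
      as (c & Hc & E).
    - intros t Ht. rewrite Rmin_left, Rmax_right in Ht by lra.
      auto_derive; [|change (Derive (fun x => f x)) with (Derive f); ring].
      apply Hf. apply Rabs_def1; lra.
    - intros t Ht. rewrite Rmin_left, Rmax_right in Ht by lra.
      apply continuity_pt_filterlim.
      apply (ex_derive_continuous (fun t => f t ^ 2)). auto_derive.
      apply Hf. apply Rabs_def1; lra.
    - rewrite Rmin_left, Rmax_right in Hc by lra.
      rewrite Heq, Rminus_diag in E. symmetry in E.
      apply Rmult_integral in E; destruct E as [E|E]; [|lra].
      apply (proj2 (Hf c ltac:(apply Rabs_def1; lra))). lra. }
  assert (Hin : forall k, 0 <= k < 1 -> Rabs (x0 + k * d - x0) < d).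
  { intros k Hk. rewrite Rabs_right; nra. }
  exists (x0 + 0 * d), (x0 + /8 * d), (x0 + /4 * d), (x0 + /2 * d), (x0 + 3/4 * d).
  repeat split; first [apply Hin; lra | apply Hinj; [apply Hin; lra | apply Hin; lra | lra]].
Qed.

(** If [f f'] were identically zero, so would be its derivative [f'^2 + f f'']. Then [f'] and
    [f f''] vanish, and the equation equates zero with [K] times the square of a number that is at
    least one. The constants [B], [Q], [W] come from the other factor at a fixed point. *)
Lemma regular_point (I : R -> Prop) (f : R -> R) (B Q W K : R) :
  open I -> (exists x, I x) ->
  (forall x, I x -> ex_derive f x /\ ex_derive (Derive f) x) ->
  0 <= Q -> 0 <= W -> K <> 0 ->
  (forall x, I x -> f x * Derive_n f 2 x * B - (Derive f x)^2 * Q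
     = K * (1 + (Derive f x)^2 * W + (f x)^2 * Q)^2) ->
  exists x, I x /\ f x * Derive f x <> 0.
Proof.
  intros HI [x Hx] Hf HQ HW HK E.
  apply NNPP; intros Hn.
  assert (Hz : forall t, I t -> f t * Derive f t = 0).
  { intros t Ht. apply NNPP; intros Ht'. apply Hn; now exists t. }
  assert (H0 : is_derive (fun t => f t * Derive f t) x 0).
  { apply (is_derive_ext_loc (fun _ => 0)).
    - apply (filter_imp I); [|now apply HI]. intros t Ht; now rewrite Hz.
    - apply (is_derive_const 0 x). }
  destruct (Hf x Hx) as [Hf1 Hf2].
  assert (H1 : Derive f x * Derive f x + f x * Derive_n f 2 x = 0).
  { apply is_derive_unique in H0. rewrite <- H0.
    symmetry. apply is_derive_unique.
    apply (is_derive_mult f (Derive f) x);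
      [now apply Derive_correct | now apply Derive_correct | apply Rmult_comm]. }
  assert (H2 : f x * Derive_n f 2 x = 0 /\ (Derive f x)^2 = 0).
  { destruct (Rmult_integral _ _ (Hz x Hx)) as [e|e]; rewrite e in *; split; lra. }
  destruct H2 as [H2 H3]. generalize (E x Hx). rewrite H2, H3.
  intros H. assert (H4 : K * (1 + 0 * W + (f x)^2 * Q)^2 = 0) by (rewrite <- H; ring).
  apply Rmult_integral in H4; destruct H4 as [H4|H4]; [tauto|].
  revert H4; apply pow_nonzero.
  generalize (Rmult_le_pos _ _ (pow2_ge_0 (f x)) HQ); lra.
Qed.

Lemma open_ball_nonzero (I : R -> Prop) (h : R -> R) (x0 : R) :
  open I -> I x0 -> continuous h x0 -> h x0 <> 0 ->
  exists d, 0 < d /\ forall x, Rabs (x - x0) < d -> I x /\ h x <> 0.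
Proof.
  intros HI Hx0 Hh Hn.
  destruct (filter_and _ _ (HI x0 Hx0) (Hh _ (open_neq 0 (h x0) Hn))) as [d Hd].
  exists d; split; [apply cond_pos|]. intros x Hx. exact (Hd x Hx).
Qed.

Lemma open_ball_Rabs (x0 d : R) : 0 < d -> open (fun x => Rabs (x - x0) < d).
Proof.
  intros Hd x Hx. assert (Hr : 0 < d - Rabs (x - x0)) by lra.
  exists (mkposreal _ Hr). intros y Hy. change (Rabs (y - x) < d - Rabs (x - x0)) in Hy.
  replace (y - x0) with ((y - x) + (x - x0)) by ring.
  generalize (Rabs_triang (y - x) (x - x0)); lra.
Qed.

Lemma regular_ball (I : R -> Prop) (f : R -> R) (x0 : R) :
  open I -> (forall x, I x -> ex_derive f x /\ ex_derive (Derive f) x) ->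
  I x0 -> f x0 * Derive f x0 <> 0 ->
  exists d, 0 < d /\ (forall x, Rabs (x - x0) < d -> I x /\ f x * Derive f x <> 0) /\
    five_values (fun x => Rabs (x - x0) < d) (fun x => (f x)^2).
Proof.
  intros HI Hf Hx0 Hn.
  destruct (open_ball_nonzero I (fun x => f x * Derive f x) x0) as (d & Hd & Hb);
    try assumption.
  - apply (ex_derive_continuous (fun x => f x * Derive f x)).
    destruct (Hf x0 Hx0). apply (ex_derive_mult f (Derive f)); assumption.
  - exists d; repeat split; try assumption; try (apply Hb; assumption).
    apply square_injective_near; [|assumption].
    intros x Hx; split; [apply Hf|]; apply Hb; assumption.
Qed.

Lemma homothetical_curvature_zero (I J : R -> Prop) (f g : R -> R) (K : R) :
  open I -> open J -> (exists x, I x) -> (exists y, J y) ->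
  (forall x, I x -> ex_derive f x /\ ex_derive (Derive f) x) ->
  (forall y, J y -> ex_derive g y /\ ex_derive (Derive g) y) ->
  (forall x y, I x -> J y ->
    f x * Derive_n f 2 x * (g y * Derive_n g 2 y) - (Derive f x)^2 * (Derive g y)^2
    = K * (1 + (Derive f x)^2 * (g y)^2 + (f x)^2 * (Derive g y)^2)^2) ->
  K = 0.
Proof.
  intros HI HJ [x Hx] [y Hy] Hf Hg E. apply NNPP; intros HK.
  destruct (regular_point I f (g y * Derive_n g 2 y) ((Derive g y)^2) ((g y)^2) K)
    as (x0 & Hx0 & Hfx0); eauto using pow2_ge_0.
  destruct (regular_point J g (f x * Derive_n f 2 x) ((Derive f x)^2) ((f x)^2) K)
    as (y0 & Hy0 & Hgy0); eauto using pow2_ge_0.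
  { intros t Ht.
    transitivity (K * (1 + (Derive f x)^2 * (g t)^2 + (f x)^2 * (Derive g t)^2)^2).
    - rewrite <- (E x t Hx Ht); ring.
    - ring. }
  clear x y Hx Hy.
  destruct (regular_ball I f x0) as (d & Hd & HX & HU); try assumption.
  destruct (regular_ball J g y0) as (e & He & HY & HW); try assumption.
  set (X := fun x => Rabs (x - x0) < d) in *.
  assert (Haff : exists al be r, forall x, X x -> (f x)^2 <> r ->
            (Derive f x)^2 = al * (f x)^2 + be).
  { destruct HW as (y1 & y2 & y3 & _ & _ & (H1 & H2 & H3 & _) & (W12 & W13 & _)
      & (W23 & _) & _).
    apply (affine_of_separated X (fun x => (f x)^2) (fun x => (Derive f x)^2)
      (fun x => f x * Derive_n f 2 x) K
      (g y1 * Derive_n g 2 y1) ((Derive g y1)^2) ((g y1)^2)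
      (g y2 * Derive_n g 2 y2) ((Derive g y2)^2) ((g y2)^2)
      (g y3 * Derive_n g 2 y3) ((Derive g y3)^2) ((g y3)^2)); try assumption;
    intros x Hx; apply E; first [apply HX; assumption | apply HY; assumption]. }
  destruct Haff as (al & be & r & Haff).
  (* A smaller ball [S], around a point where [f^2] differs from [r], is free of the exceptional
     value. *)
  assert (Hx1 : exists x1, X x1 /\ (f x1)^2 <> r).
  { destruct HU as (x1 & x2 & _ & _ & _ & (H1 & H2 & _) & (U12 & _) & _).
    destruct (Req_dec ((f x1)^2) r) as [h|h]; [|eauto].
    exists x2; split; [assumption | congruence]. }
  destruct Hx1 as (x1 & Hx1 & Hr).
  destruct (open_ball_nonzero X (fun x => (f x)^2 - r) x1) as (s & Hs & HS);
    [now apply open_ball_Rabs | assumption | | lra |].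
  { apply (ex_derive_continuous (fun x => (f x)^2 - r)). auto_derive.
    apply Hf, HX, Hx1. }
  set (S := fun x => Rabs (x - x1) < s) in *.
  assert (HUs : five_values S (fun x => (f x)^2)).
  { apply square_injective_near; [|assumption].
    intros t Ht. destruct (HX t (proj1 (HS t Ht))). split; [apply Hf|]; assumption. }
  assert (HpS : forall t, S t -> (Derive f t)^2 = al * (f t)^2 + be).
  { intros t Ht. destruct (HS t Ht). apply Haff; [assumption|lra]. }
  (* Differentiating [f'^2 = al f^2 + be] gives [f' f'' = al f f'], in which [f'] is nonzero and
     cancels. *)
  assert (HaS : forall t, S t -> f t * Derive_n f 2 t = al * (f t)^2).
  { intros t Ht. destruct (HX t (proj1 (HS t Ht))) as [HIt Hnt].
    destruct (Hf t HIt) as [hf1 hf2].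
    assert (h1 : is_derive (fun t => (Derive f t)^2) t
                   (2 * Derive f t * Derive (Derive f) t)).
    { auto_derive; [assumption|].
      change (Derive (fun x => Derive f x)) with (Derive (Derive f)). ring. }
    assert (h2 : is_derive (fun t => (Derive f t)^2) t (2 * al * (f t * Derive f t))).
    { apply (is_derive_ext_loc (fun t => al * (f t)^2 + be)).
      - apply (filter_imp S); [|now apply open_ball_Rabs].
        intros u Hu; now rewrite HpS.
      - auto_derive; [assumption|].
        change (Derive (fun x => f x)) with (Derive f). ring. }
    apply is_derive_unique in h1. apply is_derive_unique in h2.
    change (Derive_n f 2 t) with (Derive (Derive f) t).
    apply (Rmult_eq_reg_l (2 * Derive f t)).
    - transitivity (f t * (2 * Derive f t * Derive (Derive f) t)); [ring|].
      rewrite <- h1, h2; ring.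
    - intros h. apply Hnt. replace (Derive f t) with 0 by lra. ring. }
  (* For fixed [y] the equation is quadratic in [U = f^2]. The coefficient of [U^2] yields
     [g'^2 = - al g^2], which turns the constant coefficient into a quadratic in [w = g^2]. *)
  assert (Hw : forall y, Rabs (y - y0) < e ->
            K + (2 * K * be - al * be) * (g y)^2 + K * be^2 * ((g y)^2)^2 = 0).
  { intros y Hy.
    destruct (quartic_zero S (fun x => (f x)^2)
      (- be * (Derive g y)^2 - K * (1 + be * (g y)^2)^2)
      (al * (g y * Derive_n g 2 y) - al * (Derive g y)^2
        - 2 * K * (1 + be * (g y)^2) * (al * (g y)^2 + (Derive g y)^2))
      (- K * (al * (g y)^2 + (Derive g y)^2)^2) 0 0 HUs) as (c0 & _ & c2 & _).
    - intros t Ht.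
      generalize (E t y (proj1 (HX t (proj1 (HS t Ht)))) (proj1 (HY y Hy))).
      rewrite (HpS t Ht), (HaS t Ht). intros Et.
      apply Rminus_diag_eq in Et. etransitivity; [|exact Et]; ring.
    - apply Rmult_integral in c2; destruct c2 as [c2|c2]; [lra|].
      destruct (Req_dec (al * (g y)^2 + (Derive g y)^2) 0) as [h|h];
        [|exfalso; revert c2; now apply pow_nonzero].
      replace ((Derive g y)^2) with (- (al * (g y)^2)) in c0 by lra. lra. }
  (* This quadratic vanishes at five values of [w], and its constant term is [K]. *)
  destruct (quartic_zero _ _ K (2 * K * be - al * be) (K * be^2) 0 0 HW) as (h & _).
  - intros y Hy. etransitivity; [|exact (Hw y Hy)]; ring.
  - exact (HK h).
Qed.

(** * The equation f f'' = k f'^2 *)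

Lemma smooth_on_is_derive (D : R -> Prop) (f : R -> R) (n : nat) (x : R) :
  smooth_on D f -> D x -> is_derive (Derive_n f n) x (Derive_n f (S n) x).
Proof. intros Hf Hx. apply (Derive_correct (Derive_n f n)), Hf, Hx. Qed.

Lemma is_derive_Rpower_comp (f : R -> R) (e x l : R) :
  is_derive f x l -> 0 < f x ->
  is_derive (fun t => Rpower (f t) e) x (e * Rpower (f x) (e - 1) * l).
Proof.
  intros Hf Hx.
  evar_last.
  - apply (is_derive_comp (fun u => Rpower u e) f x); [|exact Hf].
    apply is_derive_Reals, derivable_pt_lim_power, Hx.
  - unfold scal; simpl; unfold mult; simpl; ring.
Qed.

Lemma Rpower_gt_0 (u e : R) : 0 < Rpower u e.
Proof. apply exp_pos. Qed.

(** By the equation [f^(-k) f'] is constant, so [f^(1-k)] is affine with nonzero slope [al] and root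
    [x0]. Inverting the power gives [f]. *)
Lemma power_form_pos (D : R -> Prop) (f : R -> R) (k a : R) :
  convex D -> k <> 1 ->
  (forall x, D x -> ex_derive f x /\ ex_derive (Derive f) x) ->
  (forall x, D x -> 0 < f x) ->
  (forall x, D x -> f x * Derive_n f 2 x = k * (Derive f x)^2) ->
  D a -> Derive f a <> 0 ->
  exists c sg x0 : R, 0 < c /\ (sg = 1 \/ sg = -1) /\
    forall x, D x -> 0 < sg * (x - x0) /\
                     f x = c * Rpower (sg * (x - x0)) (/ (1 - k)).
Proof.
  intros HD Hk Hd Hpos Hode Ha Hfa.
  set (A := Rpower (f a) (- k) * Derive f a).
  assert (HA : forall x, D x -> Rpower (f x) (- k) * Derive f x = A).
  { intros x Hx.
    apply (derive_zero_const D (fun x => Rpower (f x) (- k) * Derive f x)); try assumption.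
    clear x Hx; intros x Hx. destruct (Hd x Hx) as [h1 h2].
    apply Derive_correct in h1; apply Derive_correct in h2.
    evar_last.
    - apply (is_derive_mult (fun x => Rpower (f x) (- k)) (Derive f) x);
        [|exact h2|apply Rmult_comm].
      apply is_derive_Rpower_comp; [exact h1|now apply Hpos].
    - unfold plus, mult; simpl.
      replace (Rpower (f x) (- k)) with (Rpower (f x) (- k - 1) * f x).
      + transitivity (Rpower (f x) (- k - 1) *
          (f x * Derive (Derive f) x - k * (Derive f x)^2)); [ring|].
        change (Derive (Derive f) x) with (Derive_n f 2 x).
        rewrite (Hode x Hx); ring.
      + rewrite <- (Rpower_1 (f x)) at 2 by now apply Hpos.
        rewrite <- Rpower_plus. f_equal; ring. }
  set (al := (1 - k) * A).
  assert (Hal : al <> 0).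
  { unfold al, A. repeat apply Rmult_integral_contrapositive_currified;
      [lra | apply Rgt_not_eq, Rpower_gt_0 | assumption]. }
  set (x0 := a - Rpower (f a) (1 - k) / al).
  assert (Hh : forall x, D x -> Rpower (f x) (1 - k) = al * (x - x0)).
  { intros x Hx.
    assert (E : Rpower (f x) (1 - k) - al * x = Rpower (f a) (1 - k) - al * a).
    { apply (derive_zero_const D (fun x => Rpower (f x) (1 - k) - al * x)); try assumption.
      clear x Hx; intros x Hx. destruct (Hd x Hx) as [h1 _].
      apply Derive_correct in h1.
      evar_last.
      - apply (is_derive_minus (fun x => Rpower (f x) (1 - k)) (fun x => al * x) x).
        + apply is_derive_Rpower_comp; [exact h1|now apply Hpos].
        + apply (is_derive_scal (fun x => x) x al 1), (is_derive_id x).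
      - unfold minus, plus, opp; simpl. unfold al. rewrite <- (HA x Hx).
        replace (1 - k - 1) with (- k) by ring. ring. }
    transitivity (al * x + (Rpower (f a) (1 - k) - al * a)); [lra|].
    unfold x0; field; assumption. }
  (* Only the sign of the slope stays in the base, which keeps it positive for [Rpower]; the factor
     [Rabs al] goes into the constant [c]. *)
  set (sg := if Rlt_dec 0 al then 1 else -1).
  assert (Hsg : (sg = 1 \/ sg = -1) /\ al = Rabs al * sg).
  { unfold sg; destruct (Rlt_dec 0 al).
    - rewrite Rabs_right by lra; split; [auto|ring].
    - rewrite Rabs_left by lra; split; [auto|ring]. }
  destruct Hsg as [Hsg Hals].
  exists (Rpower (Rabs al) (/ (1 - k))), sg, x0.
  repeat split; [apply Rpower_gt_0 | assumption | |].
  - apply (Rmult_lt_reg_l (Rabs al)); [now apply Rabs_pos_lt|].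
    rewrite Rmult_0_r, <- Rmult_assoc, <- Hals, <- Hh by assumption. apply Rpower_gt_0.
  - assert (Hu : 0 < sg * (x - x0)).
    { apply (Rmult_lt_reg_l (Rabs al)); [now apply Rabs_pos_lt|].
      rewrite Rmult_0_r, <- Rmult_assoc, <- Hals, <- Hh by assumption. apply Rpower_gt_0. }
    rewrite Rpower_mult_distr by (try assumption; now apply Rabs_pos_lt).
    rewrite <- Rmult_assoc, <- Hals, <- Hh by assumption.
    rewrite Rpower_mult, Rinv_r by lra. symmetry; apply Rpower_1; now apply Hpos.
Qed.

(** The equation is invariant under [f -> s f], which reduces negative functions to positive
    ones. *)
Lemma power_form (D : R -> Prop) (f : R -> R) (s k a : R) :
  convex D -> k <> 1 -> (s = 1 \/ s = -1) ->
  (forall x, D x -> ex_derive f x /\ ex_derive (Derive f) x) ->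
  (forall x, D x -> 0 < s * f x) ->
  (forall x, D x -> f x * Derive_n f 2 x = k * (Derive f x)^2) ->
  D a -> Derive f a <> 0 ->
  exists c sg x0 : R, c <> 0 /\ (sg = 1 \/ sg = -1) /\
    forall x, D x -> 0 < sg * (x - x0) /\
                     f x = c * Rpower (sg * (x - x0)) (/ (1 - k)).
Proof.
  intros HD Hk Hs Hd Hpos Hode Ha Hfa.
  assert (Hss : s * s = 1) by (destruct Hs; subst; ring).
  assert (Hder : forall x, Derive (fun t => s * f t) x = s * Derive f x)
    by (intros; apply Derive_scal).
  destruct (power_form_pos D (fun x => s * f x) k a) as (c & sg & x0 & Hc & Hsg & H);
    try assumption.
  - intros x Hx; destruct (Hd x Hx). split.
    + apply (ex_derive_scal f); assumption.
    + apply (ex_derive_ext (fun t => s * Derive f t)); [intros; now rewrite Hder|].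
      apply (ex_derive_scal (Derive f)); assumption.
  - intros x Hx. rewrite Hder, Derive_n_scal_l.
    transitivity ((s * s) * (f x * Derive_n f 2 x)); [ring|].
    rewrite Hode by assumption. ring.
  - rewrite Hder. intros h. apply Hfa.
    replace (Derive f a) with (s * s * Derive f a) by (rewrite Hss; ring).
    rewrite Rmult_assoc, h; ring.
  - exists (s * c), sg, x0. split; [destruct Hs; subst; lra|]. split; [assumption|].
    intros x Hx. destruct (H x Hx) as [h1 h2]. split; [assumption|].
    rewrite Rmult_assoc, <- h2, <- Rmult_assoc, Hss; ring.
Qed.

(** * Higher derivatives of real powers *)

(** The falling factorial [m (m - 1) ... (m - n + 1)], the coefficient of the derivative of order
    [n] of [t^m]. It is nonzero for every [n] unless [m] is a natural number. *)
Fixpoint falling (m : R) (n : nat) : R :=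
  match n with O => 1 | S n' => falling m n' * (m - INR n') end.

Lemma falling_neq_0 (m : R) (n : nat) :
  (forall N : nat, m <> INR N) -> falling m n <> 0.
Proof.
  intros Hm; induction n as [|n IH]; simpl; [lra|].
  apply Rmult_integral_contrapositive_currified; [assumption|].
  generalize (Hm n); lra.
Qed.

Lemma Derive_n_power (D : R -> Prop) (f : R -> R) (c sg x0 m : R) :
  open D ->
  (forall x, D x -> 0 < sg * (x - x0) /\ f x = c * Rpower (sg * (x - x0)) m) ->
  forall n x, D x -> Derive_n f n x
    = c * sg^n * falling m n * Rpower (sg * (x - x0)) (m - INR n).
Proof.
  intros HD Hf; induction n as [|n IH]; intros x Hx.
  - simpl. rewrite Rminus_0_r, (proj2 (Hf x Hx)). ring.
  - change (Derive_n f (S n) x) with (Derive (Derive_n f n) x).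
    apply is_derive_unique.
    apply (is_derive_ext_loc (fun t => (c * sg^n * falling m n)
             * Rpower (sg * (t - x0)) (m - INR n))).
    + apply (filter_imp D); [|now apply HD]. intros t Ht; now rewrite IH.
    + evar_last.
      * apply (is_derive_scal (fun t => Rpower (sg * (t - x0)) (m - INR n))).
        apply (is_derive_Rpower_comp (fun t => sg * (t - x0)) _ x sg).
        -- auto_derive; [exact Logic.I|ring].
        -- apply Hf, Hx.
      * rewrite S_INR. change (falling m (S n)) with (falling m n * (m - INR n)).
        replace (m - INR n - 1) with (m - (INR n + 1)) by ring. simpl. ring.
Qed.

(** * Half-open segments and first zeros *)

(** A parameter in [[0, 1)] treats [z] to the left and to the right of [a] alike. The end [z] is
    left out (when it differs from [a]) because it will be a zero of [f]. *)
Definition seg (a z x : R) : Prop := exists t : R, 0 <= t < 1 /\ x = a + t * (z - a).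

Lemma seg_convex (a z : R) : convex (seg a z).
Proof.
  intros x y w (t & Ht & ->) (u & Hu & ->) Hw.
  destruct (Req_dec a z) as [<-|Haz]; [exists 0; split; lra|].
  exists ((w - a) / (z - a)). split; [|field; lra].
  assert (Hw' : w - a = (w - a) / (z - a) * (z - a)) by (field; lra).
  set (r := (w - a) / (z - a)) in *.
  assert (t * (z - a) <= r * (z - a) <= u * (z - a)) by lra.
  destruct (Rlt_le_dec a z).
  - split; [apply Rle_trans with t | apply Rle_lt_trans with u]; try lra;
    apply (Rmult_le_reg_r (z - a)); lra.
  - split; [apply Rle_trans with u | apply Rle_lt_trans with t]; try lra;
    apply (Rmult_le_reg_r (a - z)); lra.
Qed.

Lemma seg_in (I : R -> Prop) (a z x : R) : convex I -> I a -> I z -> seg a z x -> I x.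
Proof.
  intros HI Ha Hz (t & Ht & ->). destruct (Rle_dec a z).
  - apply (HI a z); try assumption. split; nra.
  - apply (HI z a); try assumption. split; nra.
Qed.

Lemma seg_start (a z : R) : seg a z a.
Proof. exists 0; split; lra. Qed.

Lemma seg_closure (a z : R) (h : R -> R) :
  continuous h z -> (forall x, seg a z x -> h x = 0) -> h z = 0.
Proof.
  intros Hh H0. apply NNPP; intros Hn.
  destruct (open_ball_nonzero (fun _ => True) h z open_true Logic.I Hh Hn) as (d & Hd & Hb).
  generalize (Rabs_pos (z - a)); intros HL.
  (* This step satisfies [e * Rabs (z - a) < d] and [e <= 1] even when [z = a], so the point at
     parameter [1 - e] lies on the segment and within [d] of [z]. *)
  assert (He : 0 < d / (d + Rabs (z - a)) <= 1).
  { split; [apply Rdiv_lt_0_compat; lra|].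
    apply (Rmult_le_reg_r (d + Rabs (z - a))); [lra|]. field_simplify; lra. }
  set (e := d / (d + Rabs (z - a))) in *.
  assert (Hse : seg a z (a + (1 - e) * (z - a))) by (exists (1 - e); split; lra).
  refine (proj2 (Hb (a + (1 - e) * (z - a)) _) (H0 _ Hse)).
  replace (a + (1 - e) * (z - a) - z) with (- (e * (z - a))) by ring.
  rewrite Rabs_Ropp, Rabs_mult, (Rabs_right e) by lra.
  assert (e * (d + Rabs (z - a)) = d) by (unfold e; field; lra). nra.
Qed.

(** The zero sits at the supremum [t0] of the parameters up to which [f] stays positive on the way
    from [a] to [z]. *)
Lemma first_zero (I : R -> Prop) (f : R -> R) (a z : R) :
  convex I -> (forall x, I x -> continuous f x) -> I a -> I z -> 0 < f a -> f z <= 0 ->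
  exists z0, I z0 /\ f z0 = 0 /\ forall x, seg a z0 x -> 0 < f x.
Proof.
  intros HI Hf Ha Hz Hfa Hfz.
  set (l := fun t => a + t * (z - a)).
  assert (HIl : forall t, 0 <= t <= 1 -> I (l t)).
  { intros t Ht. destruct (Rlt_le_dec t 1) as [h|h].
    - apply (seg_in I a z); try assumption. exists t; split; [lra|reflexivity].
    - unfold l; replace t with 1 by lra. replace (a + 1 * (z - a)) with z by ring. assumption. }
  assert (Hcont : forall t, 0 <= t <= 1 -> continuous (fun t => f (l t)) t).
  { intros t Ht. apply (continuous_comp l f); [|now apply Hf, HIl].
    apply (ex_derive_continuous l). unfold l; auto_derive; exact Logic.I. }
  set (E := fun t => 0 <= t <= 1 /\ forall s, 0 <= s <= t -> 0 < f (l s)).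
  assert (HE0 : E 0).
  { split; [lra|]. intros s Hs. replace s with 0 by lra. unfold l.
    replace (a + 0 * (z - a)) with a by ring. assumption. }
  destruct (completeness E) as [t0 [Hub Hlub]].
  { exists 1. intros t [Ht _]; lra. }
  { now exists 0. }
  assert (Ht0 : 0 <= t0 <= 1).
  { split; [now apply Hub|]. apply Hlub. intros t [Ht _]; lra. }
  assert (Hbelow : forall s, 0 <= s < t0 -> 0 < f (l s)).
  { intros s Hs. apply NNPP; intros Hn.
    assert (t0 <= s); [|lra]. apply Hlub. intros t [Ht Hpos].
    destruct (Rle_dec t s); [assumption|]. exfalso; apply Hn, Hpos; lra. }
  assert (Hzero : f (l t0) = 0).
  (* A negative value would already occur slightly before [t0], and a positive one would persist
     slightly beyond it. *)
  { destruct (Rtotal_order (f (l t0)) 0) as [h|[h|h]]; [|assumption|]; exfalso.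
    - destruct (Hcont t0 Ht0 _ (open_lt 0 _ h)) as [d Hd]. generalize (cond_pos d); intros Hdp.
      assert (t0 <> 0).
      { intros ->. generalize (proj2 HE0 0 ltac:(lra)); lra. }
      assert (Hs : Rmax 0 (t0 - d / 2) < t0) by (apply Rmax_lub_lt; lra).
      generalize (Rmax_l 0 (t0 - d / 2)) (Rmax_r 0 (t0 - d / 2)); intros m1 m2.
      generalize (Hbelow (Rmax 0 (t0 - d/2)) ltac:(lra)).
      assert (f (l (Rmax 0 (t0 - d / 2))) < 0); [|lra].
      apply (Hd (Rmax 0 (t0 - d / 2))).
      change (Rabs (Rmax 0 (t0 - d / 2) - t0) < d). apply Rabs_def1; lra.
    - destruct (Rle_lt_dec 1 t0) as [h1|h1].
      + assert (e : l t0 = z) by (unfold l; replace t0 with 1 by lra; ring).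
        rewrite e in h; lra.
      + destruct (Hcont t0 Ht0 _ (open_gt 0 _ h)) as [d Hd].
        generalize (cond_pos d); intros Hdp.
        generalize (Rmin_l 1 (t0 + d / 2)) (Rmin_r 1 (t0 + d / 2)); intros m1 m2.
        assert (Hs : t0 < Rmin 1 (t0 + d / 2)) by (apply Rmin_glb_lt; lra).
        assert (He : E (Rmin 1 (t0 + d / 2))); [|generalize (Hub _ He); lra].
        split; [lra|]. intros s Hs'. destruct (Rlt_le_dec s t0) as [h2|h2].
        * apply Hbelow; lra.
        * apply (Hd s). change (Rabs (s - t0) < d). apply Rabs_def1; lra. }
  exists (l t0). split; [now apply HIl|]. split; [assumption|].
  intros x (s & Hs & ->).
  replace (a + s * (l t0 - a)) with (l (s * t0)) by (unfold l; ring).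
  destruct (Req_dec t0 0) as [h|h].
  - exfalso. rewrite h in Hzero. generalize (proj2 HE0 0 ltac:(lra)); lra.
  - apply Hbelow. nra.
Qed.

(* [t^m] with [m] not a natural number has an unbounded derivative of some order at [0]. *)
Lemma power_vanishing_exponent (I : R -> Prop) (f : R -> R) (a z c sg x0 m : R) :
  smooth_on I f -> I z -> c <> 0 -> (sg = 1 \/ sg = -1) ->
  (forall x, seg a z x -> 0 < sg * (x - x0) /\ f x = c * Rpower (sg * (x - x0)) m) ->
  f z = 0 -> exists N : nat, m = INR N.
Proof.
  intros Hf Hz Hc Hsg Hform Hfz. apply NNPP; intros Hm.
  assert (Hm' : forall N, m <> INR N) by (intros N ->; apply Hm; now exists N).
  assert (Hss : sg * sg = 1) by (destruct Hsg; subst; ring).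
  assert (Hfc : continuous f z) by (apply (ex_derive_continuous f), (Hf 0%nat z Hz)).
  assert (Hua : 0 < sg * (a - x0)) by apply (Hform a (seg_start a z)).
  (* If the base were negative at [z], it would vanish inside the segment, at parameter
     [u / (u - v)]. If it were positive there, the power formula would extend by continuity and give
     [f z <> 0]. *)
  assert (Hz0 : z = x0).
  { destruct (Rtotal_order (sg * (z - x0)) 0) as [h|[h|h]].
    - exfalso. set (u := sg * (a - x0)) in *. set (v := sg * (z - x0)) in *.
      assert (Hs : seg a z (a + u / (u - v) * (z - a))).
      { exists (u / (u - v)). split; [|reflexivity].
        split; [apply Rlt_le, Rdiv_lt_0_compat; lra|].
        apply (Rmult_lt_reg_r (u - v)); [lra|].
        replace (u / (u - v) * (u - v)) with u by (field; lra). lra. }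
      generalize (proj1 (Hform _ Hs)).
      replace (sg * (a + u / (u - v) * (z - a) - x0)) with 0; [lra|].
      transitivity (u + u / (u - v) * (v - u)); [field; lra|].
      generalize (u / (u - v)); intros r. unfold u, v; ring.
    - destruct Hsg; subst; lra.
    - exfalso. generalize (seg_closure a z (fun x => f x - c * Rpower (sg * (x - x0)) m)).
      intros Hcl. rewrite Hfz in Hcl.
      assert (E : 0 - c * Rpower (sg * (z - x0)) m = 0).
      { apply Hcl.
        - apply (continuous_minus f); [assumption|].
          apply (ex_derive_continuous (fun x => c * Rpower (sg * (x - x0)) m)).
          apply (ex_derive_scal (fun x => Rpower (sg * (x - x0)) m)).
          eexists. apply (is_derive_Rpower_comp (fun t => sg * (t - x0)) _ z sg); [|assumption].
          auto_derive; [exact Logic.I|ring].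
        - intros x Hx. rewrite (proj2 (Hform x Hx)). ring. }
      assert (E' : c * Rpower (sg * (z - x0)) m = 0) by lra.
      apply Rmult_integral in E'; destruct E' as [E'|E']; [tauto|].
      generalize (Rpower_gt_0 (sg * (z - x0)) m); lra. }
  subst x0.
  set (L := sg * (a - z)) in *.
  set (D := fun x => 0 < sg * (x - z) /\ sg * (x - z) < L).
  assert (HDo : open D).
  { apply (open_comp (fun x => sg * (x - z)) (fun u => 0 < u /\ u < L)).
    - intros x _. apply (ex_derive_continuous (fun x => sg * (x - z))).
      auto_derive; exact Logic.I.
    - apply open_and; [apply open_gt | apply open_lt]. }
  assert (HD : forall x, D x ->
            0 < sg * (x - z) /\ f x = c * Rpower (sg * (x - z)) m).
  { intros x [h1 h2]. apply Hform. exists (1 - sg * (x - z) / L). split.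
    - assert (h3 : sg * (x - z) / L * L = sg * (x - z)) by (field; lra).
      split; apply (Rmult_lt_reg_r L) || (apply Rlt_le; apply (Rmult_lt_reg_r L)); nra.
    - assert (a = z + sg * L) by (unfold L; rewrite <- Rmult_assoc, Hss; ring).
      rewrite H at 1. replace (z - a) with (- (sg * L)) by lra.
      transitivity (z + sg * sg * (x - z)); [rewrite Hss; ring | field; lra]. }
  (* With [n > m + 1] the exponent [m - n] is below [-1], so [v^(m - n)] is at least [1 / v] for
     [0 < v < 1]. *)
  destruct (INR_unbounded (m + 1)) as [n Hn].
  generalize (Derive_n_power D f c sg z m HDo HD n); intros Hdn.
  set (C0 := c * sg^n * falling m n) in *.
  assert (HC0 : C0 <> 0).
  { unfold C0. repeat apply Rmult_integral_contrapositive_currified;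
      [assumption | apply pow_nonzero; destruct Hsg; lra | now apply falling_neq_0]. }
  assert (Hcn : continuous (Derive_n f n) z)
    by (apply (ex_derive_continuous (Derive_n f n)), (Hf n z Hz)).
  destruct (Hcn _ (locally_ball (Derive_n f n z) (mkposreal 1 Rlt_0_1))) as [d Hd].
  simpl in Hd. generalize (cond_pos d); intros Hdp.
  set (M := Rabs (Derive_n f n z) + 1).
  assert (HM : 0 < M) by (unfold M; generalize (Rabs_pos (Derive_n f n z)); lra).
  assert (HCp : 0 < Rabs C0) by now apply Rabs_pos_lt.
  assert (HCM : 0 < Rabs C0 / M) by now apply Rdiv_lt_0_compat.
  (* The bound [v < d] makes the derivative of order [n] smaller than [M] in absolute value by
     continuity at [z], while [v < Rabs C0 / M] makes it larger than [M]. *)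
  assert (Hv : exists v, 0 < v /\ v < L /\ v < d /\ v < 1 /\ v < Rabs C0 / M).
  { set (r := Rmin (Rmin L d) (Rmin 1 (Rabs C0 / M))).
    assert (0 < r) by (unfold r; repeat apply Rmin_glb_lt; lra).
    exists (r / 2).
    generalize (Rmin_l (Rmin L d) (Rmin 1 (Rabs C0 / M))) (Rmin_l L d) (Rmin_r L d)
      (Rmin_r (Rmin L d) (Rmin 1 (Rabs C0 / M)))
      (Rmin_l 1 (Rabs C0 / M)) (Rmin_r 1 (Rabs C0 / M)).
    fold r; intros; repeat split; lra. }
  destruct Hv as (v & Hv0 & HvL & Hvd & Hv1 & HvC).
  assert (Hsv : sg * (z + sg * v - z) = v).
  { transitivity (sg * sg * v); [ring | rewrite Hss; ring]. }
  assert (Hval : Derive_n f n (z + sg * v) = C0 * Rpower v (m - INR n)).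
  { rewrite Hdn; [now rewrite Hsv|]. split; rewrite Hsv; assumption. }
  assert (Hball : Rabs (Derive_n f n (z + sg * v) - Derive_n f n z) < 1).
  { apply (Hd (z + sg * v)). change (Rabs (z + sg * v - z) < d).
    replace (z + sg * v - z) with (sg * v) by ring.
    apply Rabs_def1; destruct Hsg; subst; lra. }
  assert (Hbig : / v <= Rpower v (m - INR n)).
  { assert (Hln : ln v < 0) by (rewrite <- ln_1; now apply ln_increasing).
    rewrite <- (exp_ln v) at 1 by assumption. rewrite <- exp_Ropp.
    left; apply exp_increasing. nra. }
  assert (Hlow : M < Rabs C0 * / v).
  { apply (Rmult_lt_reg_r v); [assumption|].
    rewrite Rmult_assoc, Rinv_l, Rmult_1_r by lra.
    apply (Rmult_lt_compat_l M) in HvC; [|assumption].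
    replace (M * (Rabs C0 / M)) with (Rabs C0) in HvC by (field; lra). assumption. }
  assert (Hup : Rabs (Derive_n f n (z + sg * v)) < M).
  { unfold M. generalize (Rabs_triang_inv (Derive_n f n (z + sg * v)) (Derive_n f n z)). lra. }
  rewrite Hval, Rabs_mult, (Rabs_right (Rpower _ _)) in Hup
    by (apply Rle_ge, Rlt_le, Rpower_gt_0).
  generalize (Rmult_le_compat_l (Rabs C0) _ _ (Rlt_le _ _ HCp) Hbig). lra.
Qed.

Lemma Derive_n_locally_const (D : R -> Prop) (f : R -> R) :
  open D -> (forall x, D x -> Derive f x = 0) ->
  forall n x, D x -> Derive_n f (S n) x = 0.
Proof.
  intros HD H0; induction n as [|n IH]; intros x Hx; [now apply H0|].
  change (Derive_n f (S (S n)) x) with (Derive (Derive_n f (S n)) x).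
  apply is_derive_unique, (is_derive_ext_loc (fun _ => 0)).
  - apply (filter_imp D); [|now apply HD]. intros t Ht; now rewrite IH.
  - apply (is_derive_const 0 x).
Qed.

(** * From local to global power forms *)

(** Since [k <> 0], a zero of [f] is also a zero of [f']. Hence [f a <> 0], and [f] keeps its sign
    on a ball. *)
Lemma power_form_near (I : R -> Prop) (f : R -> R) (k a : R) :
  open I -> smooth_on I f -> k <> 0 -> k <> 1 ->
  (forall x, I x -> f x * Derive_n f 2 x = k * (Derive f x)^2) ->
  I a -> Derive f a <> 0 ->
  exists d c sg x0 : R, 0 < d /\ c <> 0 /\ (sg = 1 \/ sg = -1) /\
    forall x, Rabs (x - a) < d ->
      0 < sg * (x - x0) /\ f x = c * Rpower (sg * (x - x0)) (/ (1 - k)).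
Proof.
  intros HI Hf Hk0 Hk1 Hode Ha Hfa.
  assert (Hfa0 : f a <> 0).
  { intros h. generalize (Hode a Ha). rewrite h, Rmult_0_l. intros E. symmetry in E.
    apply Rmult_integral in E; destruct E as [E|E]; [tauto|].
    revert E; now apply pow_nonzero. }
  set (s := if Rlt_dec 0 (f a) then 1 else -1).
  assert (Hs : (s = 1 \/ s = -1) /\ 0 < s * f a).
  { unfold s; destruct (Rlt_dec 0 (f a)); split; auto; lra. }
  destruct Hs as [Hs Hsa].
  assert (Hc : continuous (fun x => s * f x) a).
  { apply (ex_derive_continuous (fun x => s * f x)), (ex_derive_scal f), (Hf 0%nat a Ha). }
  destruct (filter_and _ _ (HI a Ha) (Hc _ (open_gt 0 _ Hsa))) as [d Hd].
  destruct (power_form (fun x => Rabs (x - a) < d) f s k a)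
    as (c & sg & x0 & Hc0 & Hsg & H); try assumption.
  - intros x y z Hx Hy Hz. apply Rabs_def2 in Hx; apply Rabs_def2 in Hy.
    apply Rabs_def1; lra.
  - intros x Hx. destruct (Hd x Hx) as [Hx' _].
    split; [apply (Hf 0%nat)|apply (Hf 1%nat)]; assumption.
  - intros x Hx. apply (Hd x Hx).
  - intros x Hx. apply Hode, (Hd x Hx).
  - rewrite Rminus_diag, Rabs_R0. apply cond_pos.
  - exists d, c, sg, x0. split; [apply cond_pos|]. auto.
Qed.

(** If the derivative of order [M + 1] were nonzero at [x], it would be nonzero on a ball. On that
    ball [f'] cannot vanish identically, and near a point where [f' <> 0] the function is a
    polynomial of degree [M]. *)
Lemma power_form_nat_Derive_n (I : R -> Prop) (f : R -> R) (k : R) (M : nat) :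
  open I -> smooth_on I f -> k <> 0 -> k <> 1 ->
  (forall x, I x -> f x * Derive_n f 2 x = k * (Derive f x)^2) ->
  / (1 - k) = INR M -> forall x, I x -> Derive_n f (S M) x = 0.
Proof.
  intros HI Hf Hk0 Hk1 Hode HM x Hx. apply NNPP; intros Hn.
  destruct (open_ball_nonzero I (Derive_n f (S M)) x) as (d & Hd & Hb); try assumption.
  { apply (ex_derive_continuous (Derive_n f (S M))), (Hf (S M) x Hx). }
  assert (Hx' : exists y, Rabs (y - x) < d /\ Derive f y <> 0).
  { apply NNPP; intros Hno. apply Hn.
    apply (Derive_n_locally_const (fun y => Rabs (y - x) < d));
      [now apply open_ball_Rabs | | rewrite Rminus_diag, Rabs_R0; assumption].
    intros y Hy. apply NNPP; intros h. apply Hno; now exists y. }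
  destruct Hx' as (y & Hy & Hfy). destruct (Hb y Hy) as [HIy HDy].
  destruct (power_form_near I f k y) as (e & c & sg & x0 & He & Hc & Hsg & H); try assumption.
  apply HDy.
  rewrite (Derive_n_power (fun t => Rabs (t - y) < e) f c sg x0 (/ (1 - k))); try assumption.
  - change (falling (/ (1 - k)) (S M)) with (falling (/ (1 - k)) M * (/ (1 - k) - INR M)).
    rewrite HM. ring.
  - now apply open_ball_Rabs.
  - rewrite Rminus_diag, Rabs_R0; assumption.
Qed.

Lemma gpow_pos (u m : R) : 0 < u -> gpow u m = Rpower u m.
Proof. intros Hu. unfold gpow. destruct (Rlt_dec 0 u); [reflexivity|tauto]. Qed.

Lemma gpow_INR (u : R) (M : nat) : gpow u (INR M) = u ^ M.
Proof.
  unfold gpow. destruct (Rlt_dec 0 u) as [Hu|Hu]; [now apply Rpower_pow|].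
  (* [up] is strictly above its argument, even at an integer. *)
  assert (Hup : up (INR M) = (Z.of_nat M + 1)%Z).
  { symmetry; apply tech_up; rewrite plus_IZR, <- INR_IZR_INZ; lra. }
  rewrite Hup, plus_IZR, <- INR_IZR_INZ.
  destruct (Req_EM_T (INR M + 1) (INR M + 1)) as [_|h]; [|tauto].
  replace (Z.of_nat M + 1 - 1)%Z with (Z.of_nat M) by lia.
  symmetry; apply pow_powerRZ.
Qed.

(** The derivative of order [M + 1] vanishes on all of [I]. Integrating back down to [f] extends the
    formula known near [a], whose values at [a] fix every constant of integration. *)
Lemma power_form_nat (I : R -> Prop) (f : R -> R) (k a : R) (M : nat) :
  open I -> convex I -> smooth_on I f -> k <> 0 -> k <> 1 ->
  (forall x, I x -> f x * Derive_n f 2 x = k * (Derive f x)^2) ->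
  I a -> Derive f a <> 0 -> / (1 - k) = INR M ->
  exists c sg x0 : R, c <> 0 /\ (sg = 1 \/ sg = -1) /\
    forall x, I x -> f x = c * (sg * (x - x0)) ^ M.
Proof.
  intros HI HIc Hf Hk0 Hk1 Hode Ha Hfa HM.
  generalize (power_form_nat_Derive_n I f k M HI Hf Hk0 Hk1 Hode HM); intros H0.
  destruct (power_form_near I f k a) as (d & c & sg & x0 & Hd & Hc & Hsg & H); try assumption.
  exists c, sg, x0. repeat split; try assumption.
  rewrite HM in H.
  assert (Haa : Rabs (a - a) < d) by (rewrite Rminus_diag, Rabs_R0; assumption).
  assert (Hval : forall j, (j <= M)%nat -> Derive_n f (M - j) a
      = c * sg^(M - j) * falling (INR M) (M - j) * (sg * (a - x0))^j).
  { intros j Hj. rewrite (Derive_n_power (fun t => Rabs (t - a) < d) f c sg x0 (INR M));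
      try assumption; [|now apply open_ball_Rabs].
    replace (INR M - INR (M - j)) with (INR j) by (rewrite minus_INR by lia; ring).
    rewrite Rpower_pow; [reflexivity | now apply H]. }
  assert (Hj : forall j, (j <= M)%nat -> forall x, I x -> Derive_n f (M - j) x
      = c * sg^(M - j) * falling (INR M) (M - j) * (sg * (x - x0))^j).
  { assert (Hstep : forall j, (j <= M)%nat ->
      (forall x, I x -> Derive_n f (S (M - j)) x
        = c * sg^(M - j) * falling (INR M) (M - j) * (INR j * sg * (sg * (x - x0))^pred j)) ->
      forall x, I x -> Derive_n f (M - j) x
        = c * sg^(M - j) * falling (INR M) (M - j) * (sg * (x - x0))^j).
    { intros j Hj HS x Hx.
      set (B := c * sg^(M - j) * falling (INR M) (M - j)) in *.
      assert (E : Derive_n f (M - j) x - B * (sg * (x - x0))^j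
                = Derive_n f (M - j) a - B * (sg * (a - x0))^j).
      { apply (derive_zero_const I (fun x => Derive_n f (M - j) x - B * (sg * (x - x0))^j));
          try assumption.
        clear x Hx; intros x Hx. evar_last.
        - apply (is_derive_minus (Derive_n f (M - j)) (fun x => B * (sg * (x - x0))^j) x).
          + now apply (smooth_on_is_derive I).
          + apply (is_derive_scal (fun x => (sg * (x - x0))^j) x B).
            apply (is_derive_pow (fun x => sg * (x - x0)) j x sg).
            auto_derive; [exact Logic.I | ring].
        - rewrite HS by assumption. unfold minus, plus, opp; simpl. ring. }
      rewrite (Hval j Hj) in E. fold B in E. lra. }
    (* The index [j] counts integrations: it starts from the constant derivative of order [M] and
       ends at [j = M] with [f] itself. *)
    induction j as [|j IH]; intros Hj; apply Hstep; try assumption; intros x Hx.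
    - rewrite Nat.sub_0_r, H0 by assumption. simpl INR. ring.
    - replace (S (M - S j)) with (M - j)%nat by lia.
      rewrite IH by (assumption || lia). simpl pred.
      replace (M - j)%nat with (S (M - S j)) by lia.
      change (falling (INR M) (S (M - S j)))
        with (falling (INR M) (M - S j) * (INR M - INR (M - S j))).
      replace (INR M - INR (M - S j)) with (INR (S j)) by (rewrite minus_INR by lia; ring).
      simpl pow. ring. }
  intros x Hx. generalize (Hj M (le_n M) x Hx). rewrite Nat.sub_diag. simpl. intros ->. ring.
Qed.

(** For a natural exponent [f] is a polynomial and may cross zero, whence [gpow]. For any other
    exponent [f] keeps the sign of [f a], because the power form holds up to a first zero, where it
    would force a natural exponent. *)
Lemma power_form_global (I : R -> Prop) (f : R -> R) (k a : R) :
  open I -> convex I -> smooth_on I f -> k <> 0 -> k <> 1 ->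
  (forall x, I x -> f x * Derive_n f 2 x = k * (Derive f x)^2) ->
  I a -> Derive f a <> 0 ->
  exists c sg x0 : R, c <> 0 /\ (sg = 1 \/ sg = -1) /\
    forall x, I x -> f x = c * gpow (sg * (x - x0)) (/ (1 - k)).
Proof.
  intros HI HIc Hf Hk0 Hk1 Hode Ha Hfa.
  destruct (classic (exists N, / (1 - k) = INR N)) as [[N HN]|Hnat].
  - destruct (power_form_nat I f k a N) as (c & sg & x0 & Hc & Hsg & H); try assumption.
    exists c, sg, x0. repeat split; try assumption.
    intros x Hx. rewrite HN, gpow_INR. now apply H.
  - destruct (power_form_near I f k a) as (d & c' & sg' & x0' & Hd & Hc' & Hsg' & Hn);
      try assumption.
    assert (Hfa0 : f a <> 0).
    { rewrite (proj2 (Hn a ltac:(rewrite Rminus_diag, Rabs_R0; assumption))).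
      apply Rmult_integral_contrapositive_currified;
        [assumption | apply Rgt_not_eq, Rpower_gt_0]. }
    clear d c' sg' x0' Hd Hc' Hsg' Hn.
    set (s := if Rlt_dec 0 (f a) then 1 else -1).
    assert (Hs : (s = 1 \/ s = -1) /\ 0 < s * f a).
    { unfold s; destruct (Rlt_dec 0 (f a)); split; auto; lra. }
    destruct Hs as [Hs Hsa].
    assert (Hpos : forall x, I x -> 0 < s * f x).
    { intros x Hx. destruct (Rlt_le_dec 0 (s * f x)) as [h|h]; [assumption|exfalso].
      destruct (first_zero I (fun x => s * f x) a x) as (z & Hz & Hfz & Hseg); try assumption.
      { intros t Ht. apply (ex_derive_continuous (fun x => s * f x)), (ex_derive_scal f),
          (Hf 0%nat t Ht). }
      destruct (power_form (seg a z) f s k a) as (c & sg & x0 & Hc & Hsg & H);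
        try assumption.
      - apply seg_convex.
      - intros t Ht. assert (I t) by (apply (seg_in I a z); assumption).
        split; [apply (Hf 0%nat)|apply (Hf 1%nat)]; assumption.
      - intros t Ht. apply Hode, (seg_in I a z); assumption.
      - apply seg_start.
      - apply Hnat, (power_vanishing_exponent I f a z c sg x0); try assumption.
        destruct Hs as [e|e]; rewrite e in Hfz; lra. }
    destruct (power_form I f s k a) as (c & sg & x0 & Hc & Hsg & H); try assumption.
    { intros t Ht. split; [apply (Hf 0%nat)|apply (Hf 1%nat)]; assumption. }
    exists c, sg, x0. repeat split; try assumption.
    intros x Hx. destruct (H x Hx). rewrite gpow_pos; assumption.
Qed.

(** * Exponential case and conclusion *)

(** The quotient [f' / f] is a constant [b], and then [f exp (- b (x - a))] is constant too. *)
Lemma exponential_form (D : R -> Prop) (f : R -> R) (a : R) :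
  convex D -> (forall x, D x -> ex_derive f x /\ ex_derive (Derive f) x) ->
  (forall x, D x -> f x <> 0) ->
  (forall x, D x -> f x * Derive_n f 2 x = (Derive f x)^2) -> D a ->
  forall x, D x -> f x = f a * exp (Derive f a / f a * (x - a)).
Proof.
  intros HD Hd Hn Hode Ha. set (b := Derive f a / f a).
  assert (Hb : forall x, D x -> Derive f x = b * f x).
  { intros x Hx.
    assert (E : Derive f x / f x = b).
    { apply (derive_zero_const D (fun x => Derive f x / f x)); try assumption.
      clear x Hx; intros x Hx. destruct (Hd x Hx) as [h1 h2].
      apply Derive_correct in h1; apply Derive_correct in h2.
      evar_last.
      - apply (is_derive_div (Derive f) f x _ _ h2 h1); now apply Hn.
      - change (Derive (Derive f) x) with (Derive_n f 2 x).
        rewrite (Rmult_comm (Derive_n f 2 x)), Hode by assumption.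
        field; now apply Hn. }
    rewrite <- E; field; now apply Hn. }
  intros x Hx.
  assert (E : f x * exp (- (b * (x - a))) = f a * exp (- (b * (a - a)))).
  { apply (derive_zero_const D (fun x => f x * exp (- (b * (x - a))))); try assumption.
    clear x Hx; intros x Hx. destruct (Hd x Hx) as [h1 _].
    auto_derive; [assumption|].
    change (Derive (fun x => f x)) with (Derive f). rewrite Hb by assumption. ring. }
  rewrite Rminus_diag, Rmult_0_r, Ropp_0, exp_0, Rmult_1_r in E.
  rewrite <- E, Rmult_assoc, <- exp_plus, Rplus_opp_l, exp_0. ring.
Qed.

Lemma exponential_form_global (I : R -> Prop) (f : R -> R) (a : R) :
  convex I -> smooth_on I f ->
  (forall x, I x -> f x * Derive_n f 2 x = (Derive f x)^2) ->
  I a -> Derive f a <> 0 ->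
  exists C b : R, b <> 0 /\ forall x, I x -> f x = C * exp (b * x).
Proof.
  intros HIc Hf Hode Ha Hfa.
  assert (Hfa0 : f a <> 0).
  { intros h. generalize (Hode a Ha). rewrite h, Rmult_0_l. intros E. symmetry in E.
    revert E; now apply pow_nonzero. }
  assert (Hdiff : forall x, I x -> ex_derive f x /\ ex_derive (Derive f) x).
  { intros x Hx. split; [apply (Hf 0%nat)|apply (Hf 1%nat)]; assumption. }
  set (s := if Rlt_dec 0 (f a) then 1 else -1).
  assert (Hs : (s = 1 \/ s = -1) /\ 0 < s * f a).
  { unfold s; destruct (Rlt_dec 0 (f a)); split; auto; lra. }
  destruct Hs as [Hs Hsa].
  (* Up to a first zero [f] is an exponential, whose limit at that point is not zero. *)
  assert (Hn : forall x, I x -> f x <> 0).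
  { intros x Hx h.
    destruct (first_zero I (fun x => s * f x) a x) as (z & Hz & Hfz & Hseg); try assumption.
    - intros t Ht. apply (ex_derive_continuous (fun x => s * f x)), (ex_derive_scal f).
      now apply Hdiff.
    - rewrite h; lra.
    - assert (Hin : forall t, seg a z t -> I t)
        by (intros t Ht; apply (seg_in I a z); assumption).
      assert (E : f z - f a * exp (Derive f a / f a * (z - a)) = 0).
      { apply (seg_closure a z (fun x => f x - f a * exp (Derive f a / f a * (x - a)))).
        - apply (ex_derive_continuous (fun x => f x - _)). auto_derive. now apply Hdiff.
        - intros t Ht. apply Rminus_diag_eq.
          apply (exponential_form (seg a z)); auto using seg_convex, seg_start.
          intros u Hu h'. generalize (Hseg u Hu). rewrite h'; lra. }
      assert (Hfz0 : f z = 0) by (destruct Hs as [e|e]; rewrite e in Hfz; lra).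
      rewrite Hfz0 in E.
      assert (E' : f a * exp (Derive f a / f a * (z - a)) = 0) by lra.
      apply Rmult_integral in E'; destruct E' as [E'|E']; [tauto|].
      generalize (exp_pos (Derive f a / f a * (z - a))); lra. }
  exists (f a * exp (- (Derive f a / f a * a))), (Derive f a / f a). split.
  - now apply Rmult_integral_contrapositive_currified; [|apply Rinv_neq_0_compat].
  - intros x Hx. rewrite (exponential_form I f a) by assumption.
    rewrite Rmult_assoc, <- exp_plus. f_equal; f_equal; ring.
Qed.

(** * Rescaling the powers and the classification *)

(** A positive factor does not change the sign of the base, so both sides fall into the same branch
    of [gpow]. In the integer branch [up m - 1] is [m]. *)
Lemma gpow_scale (l u m : R) : 0 < l -> gpow (l * u) m = Rpower l m * gpow u m.
Proof.
  intros Hl. unfold gpow. destruct (Rlt_dec 0 u) as [Hu|Hu].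
  - destruct (Rlt_dec 0 (l * u)) as [h|h]; [|exfalso; apply h; now apply Rmult_lt_0_compat].
    symmetry; now apply Rpower_mult_distr.
  - destruct (Rlt_dec 0 (l * u)) as [h|h]; [exfalso; nra|].
    destruct (Req_EM_T (IZR (up m)) (m + 1)) as [e|e]; [|ring].
    rewrite powerRZ_mult, powerRZ_Rpower by assumption.
    rewrite minus_IZR, e. do 2 f_equal; ring.
Qed.

(** The absolute value of [c1 * c2] is the power [m] of a positive [l], which scales the first base.
    Its sign cannot be absorbed that way and remains as [eps]. *)
Lemma product_of_powers (I J : R -> Prop) (f g : R -> R) (c1 s1 x0 c2 s2 y0 m : R) :
  c1 <> 0 -> c2 <> 0 -> (s1 = 1 \/ s1 = -1) -> (s2 = 1 \/ s2 = -1) ->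
  m <> 0 -> m <> 1 ->
  (forall x, I x -> f x = c1 * gpow (s1 * (x - x0)) m) ->
  (forall y, J y -> g y = c2 * gpow (s2 * (y - y0)) (1 - m)) ->
  exists eps b c d e : R, (eps = 1 \/ eps = -1) /\ b <> 0 /\ c <> 0 /\
    forall x y, I x -> J y ->
      f x * g y = eps * gpow (b * x / m + d) m * gpow (c * y / (m - 1) + e) (1 - m).
Proof.
  intros Hc1 Hc2 Hs1 Hs2 Hm0 Hm1 Hf Hg.
  assert (Hc : c1 * c2 <> 0) by now apply Rmult_integral_contrapositive_currified.
  set (l := Rpower (Rabs (c1 * c2)) (/ m)).
  assert (Hl : 0 < l) by apply exp_pos.
  assert (Heps : exists eps, (eps = 1 \/ eps = -1) /\ c1 * c2 = eps * Rpower l m).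
  { assert (E : Rpower l m = Rabs (c1 * c2)).
    { unfold l. rewrite Rpower_mult, Rinv_l by assumption.
      apply Rpower_1; now apply Rabs_pos_lt. }
    rewrite E. destruct (Rle_dec 0 (c1 * c2)) as [h|h].
    - exists 1. rewrite Rabs_right by lra. split; [auto|ring].
    - exists (-1). rewrite Rabs_left by lra. split; [auto|ring]. }
  destruct Heps as (eps & Heps & E).
  (* These coefficients turn the two bases into [l * (s1 * (x - x0))] and [s2 * (y - y0)]. *)
  exists eps, (m * l * s1), (s2 * (m - 1)), (- (l * s1 * x0)), (- (s2 * y0)).
  split; [assumption|].
  split; [repeat apply Rmult_integral_contrapositive_currified; destruct Hs1; lra|].
  split; [apply Rmult_integral_contrapositive_currified; destruct Hs2; lra|].
  intros x y Hx Hy.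
  replace (m * l * s1 * x / m + - (l * s1 * x0)) with (l * (s1 * (x - x0)))
    by (field; assumption).
  replace (s2 * (m - 1) * y / (m - 1) + - (s2 * y0)) with (s2 * (y - y0))
    by (field; lra).
  rewrite gpow_scale, Hf, Hg by assumption.
  transitivity (c1 * c2 * gpow (s1 * (x - x0)) m * gpow (s2 * (y - y0)) (1 - m)); [ring|].
  rewrite E; ring.
Qed.

Lemma Derive_zero_const (D : R -> Prop) (f : R -> R) :
  convex D -> smooth_on D f -> ~ (exists x, D x /\ Derive f x <> 0) ->
  forall x y, D x -> D y -> f x = f y.
Proof.
  intros HD Hf Hn. apply derive_zero_const; [assumption|].
  intros x Hx. replace 0 with (Derive f x).
  - apply Derive_correct, (Hf 0%nat x Hx).
  - apply NNPP; intros h; apply Hn; now exists x.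
Qed.

Theorem theorem3 (a1 a2 b1 b2 : Rbar) (f g : R -> R) (K : R) :
  Rbar_lt a1 a2 -> Rbar_lt b1 b2 ->
  smooth_on (open_itv a1 a2) f ->
  smooth_on (open_itv b1 b2) g ->
  (forall x y, open_itv a1 a2 x -> open_itv b1 b2 y ->
     gauss_curvature_graph (fun u v => f u * g v) x y = K) ->
  K = 0 /\
  (cylindrical_graph (open_itv a1 a2) (open_itv b1 b2)
      (fun u v => f u * g v)
   \/ (exists a b c : R, 0 < a /\ 0 < b /\ 0 < c /\
        forall x y, open_itv a1 a2 x -> open_itv b1 b2 y ->
          f x * g y = a * exp (b * x + c * y))
   \/ (exists eps b c d e m : R, (eps = 1 \/ eps = -1) /\
        b <> 0 /\ c <> 0 /\ m <> 0 /\ m <> 1 /\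
        forall x y, open_itv a1 a2 x -> open_itv b1 b2 y ->
          f x * g y = eps * gpow (b * x / m + d) m
                          * gpow (c * y / (m - 1) + e) (1 - m))).
Proof.
  intros Ha Hb Hf Hg HK.
  generalize (open_itv_inhabited a1 a2 Ha) (open_itv_inhabited b1 b2 Hb)
    (open_itv_open a1 a2) (open_itv_open b1 b2)
    (open_itv_convex a1 a2) (open_itv_convex b1 b2).
  set (I := open_itv a1 a2) in *. set (J := open_itv b1 b2) in *.
  intros HIn HJn HIo HJo HIc HJc. clear Ha Hb.
  assert (E : forall x y, I x -> J y ->
    f x * Derive_n f 2 x * (g y * Derive_n g 2 y) - (Derive f x)^2 * (Derive g y)^2
    = K * (1 + (Derive f x)^2 * (g y)^2 + (f x)^2 * (Derive g y)^2)^2)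
    by (intros x y Hx Hy; now apply curvature_homothetical, HK).
  assert (K0 : K = 0).
  { apply (homothetical_curvature_zero I J f g K); try assumption;
    intros t Ht; split;
    first [now apply (Hf 0%nat) | now apply (Hf 1%nat)
          | now apply (Hg 0%nat) | now apply (Hg 1%nat)]. }
  split; [assumption|].
  rewrite K0 in E. clear K K0 HK.
  destruct (classic (exists x, I x /\ Derive f x <> 0)) as [(x0 & Hx0 & Hfx0)|Hf0].
  (* A constant factor [f] makes the graph invariant along the [x] axis; a constant [g] does the
     same for the [y] axis. *)
  2: { left. exists 1, 0, 0. split; [left; lra|]. intros x y t Hx _ Hx' _.
       rewrite (Derive_zero_const I f HIc Hf Hf0 _ x Hx' Hx), !Rmult_0_r, !Rplus_0_r.
       reflexivity. }
  destruct (classic (exists y, J y /\ Derive g y <> 0)) as [(y0 & Hy0 & Hgy0)|Hg0].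
  2: { left. exists 0, 1, 0. split; [right; lra|]. intros x y t _ Hy _ Hy'.
       rewrite (Derive_zero_const J g HJc Hg Hg0 _ y Hy' Hy), !Rmult_0_r, !Rplus_0_r.
       reflexivity. }
  (* The separation constant, read off at [y0]. Its denominator is nonzero, since otherwise the
     equation at [(x0, y0)] would give [f' g' = 0]. *)
  set (k := (Derive g y0)^2 / (g y0 * Derive_n g 2 y0)).
  assert (Pf : (Derive f x0)^2 <> 0) by now apply pow_nonzero.
  assert (Pg : (Derive g y0)^2 <> 0) by now apply pow_nonzero.
  assert (Hgg : g y0 * Derive_n g 2 y0 <> 0).
  { intros h. generalize (E x0 y0 Hx0 Hy0). rewrite h. intros h'.
    assert (h2 : (Derive f x0)^2 * (Derive g y0)^2 = 0) by lra.
    apply Rmult_integral in h2; tauto. }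
  assert (Hk : k <> 0)
    by (now apply Rmult_integral_contrapositive_currified; [|apply Rinv_neq_0_compat]).
  assert (Ef : forall x, I x -> f x * Derive_n f 2 x = k * (Derive f x)^2).
  { intros x Hx. apply (Rmult_eq_reg_r (g y0 * Derive_n g 2 y0)); [|assumption].
    transitivity ((Derive f x)^2 * (Derive g y0)^2).
    - generalize (E x y0 Hx Hy0); lra.
    - unfold k; field. split; intros h; apply Hgg; rewrite h; ring. }
  assert (Eg : forall y, J y -> g y * Derive_n g 2 y = / k * (Derive g y)^2).
  { intros y Hy. generalize (E x0 y Hx0 Hy). rewrite Ef by assumption. intros h.
    apply (Rmult_eq_reg_l (k * (Derive f x0)^2));
      [|now apply Rmult_integral_contrapositive_currified].
    transitivity ((Derive f x0)^2 * (Derive g y)^2); [lra | field; assumption]. }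
  clearbody k. clear Hgg.
  destruct (Req_dec k 1) as [Hk1|Hk1].
  - left. rewrite Hk1 in Ef, Eg.
    destruct (exponential_form_global I f x0) as (C1 & b & Hb & Hff); try assumption.
    { intros x Hx; rewrite Ef by assumption; ring. }
    destruct (exponential_form_global J g y0) as (C2 & c & Hc & Hgf); try assumption.
    { intros y Hy; rewrite Eg by assumption; field. }
    (* The exponent [b x + c y] is constant along [(c, -b)], so the rulings are horizontal. *)
    exists c, (- b), 0. split; [now left|]. intros x y t Hx Hy Hx' Hy'.
    rewrite !Hff, !Hgf by assumption.
    transitivity (C1 * C2 * (exp (b * (x + t * c)) * exp (c * (y + t * - b)))); [ring|].
    rewrite <- exp_plus.
    replace (b * (x + t * c) + c * (y + t * - b)) with (b * x + c * y) by ring.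
    rewrite exp_plus; ring.
  - right; right.
    assert (Hk1' : / k <> 1) by (intros h; apply Hk1; rewrite <- (Rinv_inv k), h; field).
    destruct (power_form_global I f k x0) as (c1 & s1 & u0 & Hc1 & Hs1 & Hff);
      try assumption.
    destruct (power_form_global J g (/ k) y0) as (c2 & s2 & v0 & Hc2 & Hs2 & Hgf);
      try assumption; [now apply Rinv_neq_0_compat|].
    (* Replacing [k] by [/ k] replaces the exponent [m = / (1 - k)] by [1 - m]. *)
    assert (Hm : / (1 - / k) = 1 - / (1 - k)) by (field; repeat split; lra).
    rewrite Hm in Hgf.
    assert (Hm0 : / (1 - k) <> 0) by (apply Rinv_neq_0_compat; lra).
    assert (Hm1 : / (1 - k) <> 1).
    { intros h. apply Hk. rewrite <- Rinv_1 in h. apply Rinv_eq_reg in h. lra. }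
    destruct (product_of_powers I J f g c1 s1 u0 c2 s2 v0 (/ (1 - k)))
      as (eps & b & c & d & e & He & Hb & Hc & H); try assumption.
    exists eps, b, c, d, e, (/ (1 - k)). auto 10.
Qed.
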